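(* Let $D$ be a division ring with center $F$. Let $N$ be a subnormal subgroup of $D^*$ containing a non-abelian solvable subgroup $H$. If $H$ is algebraic over $F$, then $N$ contains a non-abelian free subgroup.
   Context: $D^*$ denotes the multiplicative group of nonzero elements of $D$. A subgroup $N$ of a group $G$ is subnormal if there is a finite series $N=N_n\triangleleft N_{n-1}\triangleleft\cdots\triangleleft N_0=G$, each term being normal in the next larger one. A subset $H$ of $D$ is algebraic over $F$ if every element of $H$ is a root of some nonzero polynomial with coefficients in $F$. *)

(* Defs.v *)
From HB Require Import structures.
From mathcomp Require Import all_boot all_order all_algebra.
From mathcomp Require Import boolp classical_sets.

Set Implicit Arguments.
Unset Strict Implicit.
Unset Printing Implicit Defensive.

Import GRing.Theory.

Local Open Scope classical_set_scope.

(* MathComp's {group gT} only covers finite groups, so subgroups of a          *)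
(* possibly infinite group are taken as classical sets closed under x / y.     *)
Section Groups.
Local Open Scope group_scope.
Variable G : groupType.
Implicit Types (H K N X A B : set G) (w : seq (G * bool)).

Definition is_subgroup H : Prop :=
  H 1 /\ forall x y, H x -> H y -> H (x / y).

Definition is_normal N H : Prop :=
  [/\ is_subgroup N, is_subgroup H, N `<=` H
    & forall x h, N x -> H h -> N (x ^ h)].

(* S i is the i-th term of N = S n <| ... <| S 1 <| S 0 = H.                   *)
Definition is_subnormal N H : Prop :=
  is_subgroup H /\
  exists n (S : nat -> set G),
    [/\ S 0%N = H, S n = N & forall i, (i < n)%N -> is_normal (S i.+1) (S i)].

Definition is_abelian H : Prop := forall x y, H x -> H y -> commute x y.

Definition gen A : set G := smallest is_subgroup A.

Definition commutator_subgroup A B : set G :=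
  gen [set z | exists x y, [/\ A x, B y & z = [~ x, y]]].

Definition derived_series H (n : nat) : set G :=
  iter n (fun K => commutator_subgroup K K) H.

Definition is_solvable H : Prop :=
  exists n, derived_series H n = [set 1].

(* A word is a sequence of letters (x, e), where (x, true) stands for x and    *)
(* (x, false) for the formal inverse of x; it is reduced when no letter is     *)
(* followed by its formal inverse.                                             *)
Definition word_val w : G := \prod_(a <- w) (if a.2 then a.1 else a.1^-1).

Definition word_reduced w : bool :=
  sorted (fun a b => ~~ ((a.1 == b.1) && (a.2 != b.2))) w.

Definition word_over X w : Prop := forall a, a \in w -> X a.1.

Definition is_free_on X K : Prop :=
  K = gen X /\
  forall w, word_over X w -> word_reduced w -> w <> [::] -> word_val w <> 1.

Definition is_free K : Prop := exists X, is_free_on X K.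

End Groups.

Section UnitGroup.
Local Open Scope ring_scope.
Variable D : unitRingType.

(* MathComp's {unit D} requires D to be finite; this is the same construction  *)
(* for an arbitrary ring with units.                                           *)
Record unit_group := UnitGroup {
  unit_val :> D;
  unit_valP : unit_val \is a GRing.unit }.

HB.instance Definition _ := [isSub for unit_val].
HB.instance Definition _ := [Choice of unit_group by <:].

Implicit Types u v : unit_group.

Definition unit_one := UnitGroup (@unitr1 D).

Fact unit_inv_proof u : (val u)^-1 \is a GRing.unit.
Proof. by rewrite unitrV (valP u). Qed.
Definition unit_inv u := UnitGroup (unit_inv_proof u).

Fact unit_mul_proof u v : val u * val v \is a GRing.unit.
Proof. by rewrite unitrMr ?(valP u) ?(valP v). Qed.
Definition unit_mul u v := UnitGroup (unit_mul_proof u v).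

Fact unit_mulA : associative unit_mul.
Proof. by move=> u v w; apply/val_inj/mulrA. Qed.
Fact unit_mul1 : left_id unit_one unit_mul.
Proof. by move=> u; apply/val_inj/mul1r. Qed.
Fact unit_mulr1 : right_id unit_one unit_mul.
Proof. by move=> u; apply/val_inj/mulr1. Qed.
Fact unit_mulV : left_inverse unit_one unit_inv unit_mul.
Proof. by move=> u; apply/val_inj/mulVr/(valP u). Qed.
Fact unit_mulrV : right_inverse unit_one unit_inv unit_mul.
Proof. by move=> u; apply/val_inj/mulrV/(valP u). Qed.

HB.instance Definition _ := isGroup.Build unit_group
  unit_mulA unit_mul1 unit_mulr1 unit_mulV unit_mulrV.

(* GRing.field_axiom does not mention commutativity: it says exactly that      *)
(* every nonzero element is a (two-sided) unit.                                *)
Definition is_division_ring : Prop := GRing.field_axiom D.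

(* Hence unit_group D is the group D^* of nonzero elements.                    *)
Fact division_ring_unitE (hD : is_division_ring) (x : D) :
  (x \is a GRing.unit) = (x != 0).
Proof.
by apply/idP/idP => [|/hD //]; apply: contraTneq => ->; rewrite unitr0.
Qed.

Definition center : set D := [set z | forall x, GRing.comm z x].

Definition algebraic_over (F A : set D) : Prop :=
  forall a, A a ->
    exists p : {poly D}, [/\ p != 0, forall i, F p`_i & root p a].

End UnitGroup.

Arguments center D : clear implicits.

(* Main.v *)
From HB Require Import structures.
Require Import Defs.
From mathcomp Require Import all_boot all_order all_algebra.
From mathcomp Require Import boolp classical_sets.
From mathcomp Require Import cyclic finfield ring.

(* A non-abelian solvable group H contains non-commuting x and y such that all
   the conjugates x_i = y^i x y^-i commute.  As x is algebraic over the center,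
   some power y^n, n > 1, commutes with x; for the least such n, conjugation by
   y is an automorphism sigma of order n on a commutative field K containing
   the x_i and c = y^n, and K[y] is a cyclic algebra.

   Instead of Tits' alternative we play an algebraic ping-pong.  For omega in a
   well-chosen ring P of sigma-fixed elements of K (the integers, or a
   polynomial ring) put Y = omega y and eps = 1 - omega^n c = 1 - Y^n.  For a
   suitable omega, eps is not invertible in a sigma-stable ring R containing
   the finitely many elements of K that intervene below and their inverses.
   Then (1 - Y) tau = eps for tau = 1 + Y + ... + Y^(n-1), so modulo eps the
   element tau acts as an operator of rank one, th |-> trace th.  Iterated
   commutators with x of a conjugate of (1 - Y) b (1 - Y), b in K, lie in N
   after finitely many steps, and up to a power of eps they and their inverses
   also act modulo eps as operators of rank one.  For generic b and for two
   generic conjugates no product of such operators along a reduced word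
   vanishes modulo eps, so no nonempty reduced word is equal to 1.

   When x and c are algebraic over a finite field such a P need not exist, but
   then x and y generate a finite ring, against Wedderburn's theorem. *)

Set Implicit Arguments.
Unset Strict Implicit.
Unset Printing Implicit Defensive.

Import GRing.Theory.

Local Open Scope classical_set_scope.
Local Open Scope ring_scope.

(** * Domains over which every nonconstant polynomial takes a nonunit value *)

Definition has_nonunit_values (P : idomainType) : Prop :=
  forall G : {poly P}, (1 < size G)%N -> exists l, G.[l] \isn't a GRing.unit.

Lemma poly_nonroot (R : idomainType) (f : nat -> R) (p : {poly R}) :
  injective f -> p != 0 -> exists i, p.[f i] != 0.
Proof.
move=> f_inj p_neq0; apply: contrapT => /forallNP p0.
suff : (size (map f (iota 0 (size p))) < size p)%N by rewrite size_map size_iota ltnn.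
apply: max_poly_roots => //; last by rewrite map_inj_uniq ?iota_uniq.
by apply/allP=> _ /mapP[i _ ->]; apply/negPn/negP/p0.
Qed.

(** The units of [int] are 1 and -1, so if all values were units, [G * G - 1] would vanish at every
    natural number, although [G * G] is not constant. *)
Lemma int_nonunit_values : has_nonunit_values int.
Proof.
move=> G sG; apply: contrapT => /forallNP H.
have inj : injective (fun n : nat => n%:Z) by move=> m n [].
have sGG : (1 < size (G * G)%R)%N.
  have G_neq0 : G != 0 by rewrite -size_poly_gt0 (ltn_trans _ sG).
  by rewrite size_mul //; case: (size G) sG => [|[|m]] // _; rewrite addnS /= addSn.
have : G * G - 1 != 0.
  by apply: contraTneq sGG => /eqP; rewrite subr_eq0 => /eqP ->; rewrite size_poly1.
case/(poly_nonroot inj) => i /eqP; apply.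
rewrite hornerD hornerM hornerN hornerC.
have /negP := H i%:Z; rewrite negbK => /orP[] /eqP ->.
- by rewrite mulr1 subrr.
- by rewrite mulrNN mulr1 subrr.
Qed.

(** Kronecker substitution: the coefficients have degree less than N, so the terms of [G.['X^N]]
    occupy disjoint ranges of degrees and the top one survives. *)
Lemma size_horner_Xn (B : idomainType) (N : nat) (G : {poly {poly B}}) :
  (0 < N)%N -> G != 0 -> (forall i, (size (G`_i)%R <= N)%N) ->
  (N * (size G).-1 < size (G.['X^N])%R)%N.
Proof.
move=> N_gt0; elim/poly_ind: G => [|q c IH]; first by rewrite eqxx.
have [->|q_neq0] := eqVneq q 0.
  rewrite mul0r add0r hornerC polyC_eq0 => c_neq0 _.
  by rewrite size_polyC c_neq0 muln0 size_poly_gt0.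
move=> _ hsize.
have hc : (size c <= N)%N by have := hsize 0; rewrite -cons_poly_def coef_cons.
have hq i : (size (q`_i)%R <= N)%N.
  by have := hsize i.+1; rewrite -cons_poly_def coef_cons.
have := IH q_neq0 hq; set m := size q.['X^N] => hm.
rewrite hornerMXaddC -cons_poly_def size_cons_poly nil_poly (negPf q_neq0) /=.
have q0 : q.['X^N] != 0 by rewrite -size_poly_gt0 (leq_ltn_trans _ hm).
have sM : size (q.['X^N] * 'X^N)%R = (m + N)%N.
  by rewrite size_mul ?size_polyXn ?addnS // -size_poly_gt0 size_polyXn.
rewrite size_polyDl sM.
  by case: (size q) hm (size_poly_gt0 q) => [|k] /=; rewrite ?q_neq0 // => hm _;
    rewrite mulnS addnC ltn_add2r.
by rewrite (leq_ltn_trans hc) // -{1}[N]add0n ltn_add2r (leq_ltn_trans _ hm).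
Qed.

Lemma poly_nonunit_values (B : idomainType) : has_nonunit_values {poly B}.
Proof.
move=> G sG.
pose N := (\sum_(i < size G) size (G`_i)%R)%N.+1.
have G_neq0 : G != 0 by rewrite -size_poly_gt0 (ltn_trans _ sG).
have hN i : (size (G`_i)%R <= N)%N.
  case: (ltnP i (size G)) => hi; last by rewrite nth_default ?size_poly0.
  by rewrite /N (bigD1 (Ordinal hi)) //=; apply/leqW/leq_addr.
exists 'X^N; apply/negP; rewrite poly_unitE => /andP[/eqP s1 _].
have := size_horner_Xn (ltn0Sn _ : 0 < N)%N G_neq0 hN.
rewrite s1 ltnS leqn0 muln_eq0 /=.
by case: (size G) sG => [|[|]].
Qed.

(** * Algebraic and integral elements over a domain embedded in a field *)

Section AlgOver.
Variables (P : idomainType) (K : fieldType) (iota : {rmorphism P -> K}).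
Hypothesis iota_inj : injective iota.

(** As [iota] is injective, this is algebraicity over the fraction field of P, with denominators
    cleared. *)
Definition alg_over (z : K) : Prop :=
  exists2 p : {poly P}, p != 0 & root (map_poly iota p) z.

Lemma iota_eq0 a : (iota a == 0) = (a == 0).
Proof. by rewrite -{1}(rmorph0 iota) (inj_eq iota_inj). Qed.

Lemma integral_lead (p : {poly K}) z :
  root p z -> (forall i, integralOver iota p`_i) ->
  integralOver iota (lead_coef p * z).
Proof.
have [->|p_neq0] := eqVneq p 0.
  by move=> _ _; rewrite lead_coef0 mul0r; exact: integral0.
move=> pz0 int_p; set a := lead_coef p.
have sp : (0 < size p)%N by rewrite size_poly_gt0.
have s_gt1 := root_size_gt1 p_neq0 pz0.
set m := (size p).-2; have sE : size p = m.+2 by rewrite /m; case: (size p) s_gt1 => [|[|]].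
pose q := \poly_(i < m.+2) (if i == m.+1 then 1 else a ^+ (m - i) * p`_i).
have lq : q`_m.+1 = 1 by rewrite coef_poly ltnSn eqxx.
have sq : size q = m.+2 by apply: size_poly_eq; rewrite eqxx oner_neq0.
have int_a : integralOver iota a by apply: int_p.
have int_an k : integralOver iota (a ^+ k).
  by elim: k => [|k IH]; [exact: integral1 | rewrite exprS; apply: integral_mul].
apply: (@integral_root_monic _ _ _ _ q).
- by apply/monicP; rewrite lead_coefE sq.
- apply/rootP; rewrite horner_coef sq big_ord_recr /= lq mul1r.
  move/rootP: pz0; rewrite horner_coef sE big_ord_recr /= -[X in p`_X]/(m.+2.-1) -sE
    -lead_coefE -/a => pz0.
  have -> : (a * z) ^+ m.+1 = a ^+ m * (a * z ^+ m.+1).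
    by rewrite exprMn exprSr mulrA.
  transitivity (a ^+ m * 0); last by rewrite mulr0.
  rewrite -[X in _ = _ * X]pz0 mulrDr; congr (_ + _); rewrite mulr_sumr; apply: eq_bigr => i _.
  rewrite coef_poly ltnS (ltnW (ltn_ord i)) ltn_eqF ?ltn_ord //.
  have hi : (i <= m)%N by rewrite -ltnS.
  by rewrite exprMn mulrACA -exprD subnK.
- apply/integral_poly => i; rewrite coef_poly; case: ifP => _; last exact: integral0.
  by case: ifP => _; [exact: integral1 | apply: integral_mul].
Qed.

(** Through this equivalence, algebraic elements inherit closure under sums and products from
    integral ones. *)
Lemma alg_integral z :
  alg_over z <-> exists2 a, a != 0 & integralOver iota (iota a * z).
Proof.
split=> [[p p_neq0 pz0]|[a a_neq0 [q mon_q qz0]]].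
  exists (lead_coef p); first by rewrite lead_coef_eq0.
  rewrite -lead_coef_map_inj ?rmorph0 //; apply: integral_lead => // i.
  by rewrite coef_map; apply: integral_id.
exists (q \Po (a *: 'X)).
  rewrite comp_poly_eq0 ?monic_neq0 //.
  by rewrite size_scale // size_polyX.
by rewrite map_comp_poly /= map_polyZ /= map_polyX rootE horner_comp hornerZ hornerX.
Qed.

Lemma integral_iotaM a z : integralOver iota z -> integralOver iota (iota a * z).
Proof. by move=> iz; apply: integral_mul => //; apply: integral_id. Qed.

Lemma alg_id a : alg_over (iota a).
Proof. by apply/alg_integral; exists 1; rewrite ?oner_neq0 // rmorph1 mul1r; apply: integral_id. Qed.

Lemma alg_add z w : alg_over z -> alg_over w -> alg_over (z + w).
Proof.
move=> /alg_integral[a a0 ia] /alg_integral[b b0 ib]; apply/alg_integral.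
exists (a * b); first by rewrite mulf_neq0.
rewrite rmorphM mulrDr; apply: integral_add; last by rewrite -mulrA; apply: integral_iotaM.
by rewrite mulrAC mulrC; apply: integral_iotaM.
Qed.

Lemma alg_mul z w : alg_over z -> alg_over w -> alg_over (z * w).
Proof.
move=> /alg_integral[a a0 ia] /alg_integral[b b0 ib]; apply/alg_integral.
exists (a * b); first by rewrite mulf_neq0.
by rewrite rmorphM mulrACA; apply: integral_mul.
Qed.

Lemma alg_opp z : alg_over z -> alg_over (- z).
Proof. by rewrite -mulN1r -(rmorphN1 iota); apply: alg_mul; apply: alg_id. Qed.

Lemma alg_sum (I : Type) (r : seq I) (Q : pred I) (F : I -> K) :
  (forall i, Q i -> alg_over (F i)) -> alg_over (\sum_(i <- r | Q i) F i).
Proof.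
move=> H; elim/big_ind : _ => //; last exact: alg_add.
by rewrite -(rmorph0 iota); apply: alg_id.
Qed.

(** The coefficients of an equation of z, read in reverse order, give an equation of its inverse. *)
Lemma alg_inv z : alg_over z -> alg_over z^-1.
Proof.
have [->|z_neq0] := eqVneq z 0; first by rewrite invr0.
case=> p p_neq0 /rootP pz0; set m := (size p).-1.
have sE : size p = m.+1 by rewrite prednK // size_poly_gt0.
exists (\poly_(i < m.+1) p`_(m - i)).
  apply/negP => /eqP /polyP /(_ 0); rewrite coef_poly ltn0Sn subn0 coef0 => /eqP.
  by rewrite -lead_coefE lead_coef_eq0 (negPf p_neq0).
apply/rootP; have /(congr1 ( *%R (z ^- m))) := pz0; rewrite mulr0 => <-.
rewrite (@horner_coef_wide _ m.+1) ?(leq_trans (size_map_poly_leq _ _)) ?size_poly //; last first.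
  by rewrite size_map_inj_poly ?rmorph0 // size_poly.
rewrite (@horner_coef_wide _ m.+1 (map_poly iota p)) ?size_map_inj_poly ?rmorph0 ?sE //.
rewrite mulr_sumr (reindex_inj rev_ord_inj); apply: eq_bigr => i _ /=.
rewrite !coef_map /= coef_poly subSS ltnS leq_subr subKn -1?ltnS //.
rewrite mulrCA; congr (_ * _); rewrite exprVn.
have hi : (i <= m)%N by rewrite -ltnS.
have -> : z ^+ m = z ^+ (m - i) * z ^+ i by rewrite -exprD subnK.
by rewrite invfM -mulrA mulVf ?mulr1 ?expf_neq0.
Qed.

Lemma common_integral (s : seq K) : (forall z, z \in s -> alg_over z) ->
  exists2 a, a != 0 & forall z, z \in s -> integralOver iota (iota a * z).
Proof.
elim: s => [|z s IH] hs; first by exists 1 => //; rewrite oner_neq0.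
have [|a a0 ia] := IH; first by move=> w ws; apply: hs; rewrite in_cons ws orbT.
have /alg_integral[b b0 ib] := hs z (mem_head _ _).
exists (a * b); first by rewrite mulf_neq0.
move=> w; rewrite in_cons rmorphM => /predU1P[->|ws].
  by rewrite -mulrA; apply: integral_iotaM.
by rewrite mulrAC mulrC; apply/integral_iotaM/ia.
Qed.

(** A common denominator of the coefficients of p makes them integral; [integral_lead] then applies,
    and the factors in front of z are divided out. *)
Lemma alg_trans (p : {poly K}) z :
  p != 0 -> root p z -> (forall i, alg_over p`_i) -> alg_over z.
Proof.
move=> p_neq0 pz0 alg_p.
have [|a a_neq0 ia] := @common_integral p.
  by move=> w /(nthP 0)[i _ <-].
have a0 : iota a != 0 by rewrite iota_eq0.
have int_lead : integralOver iota (lead_coef (iota a *: p) * z).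
  apply: integral_lead; first by rewrite rootZ.
  move=> i; rewrite coefZ; have [hi|hi] := ltnP i (size p).
    by apply/ia/mem_nth.
  by rewrite nth_default // mulr0; apply: integral0.
have lp0 : lead_coef p != 0 by rewrite lead_coef_eq0.
rewrite lead_coefZ in int_lead.
have -> : z = (iota a * lead_coef p * z) * (lead_coef p)^-1 * (iota a)^-1.
  by rewrite (mulrAC (iota a)) mulfK // mulrAC mulfV // mul1r.
apply: alg_mul; last exact/alg_inv/alg_id.
apply: alg_mul; last exact/alg_inv/alg_p.
by apply/alg_integral; exists 1; rewrite ?oner_neq0 // rmorph1 mul1r.
Qed.

End AlgOver.

(** * Integral elements away from delta, and the choice of omega *)

Section IntegralFractions.
Variables (P : idomainType) (K : fieldType) (iota : {rmorphism P -> K}).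
Hypothesis iota_inj : injective iota.
Variable delta : P.

(** For nonzero delta, the integral closure in K of the localization of P at delta. It will serve as
    the ring R. *)
Definition int_frac (z : K) : Prop := exists N, integralOver iota (iota delta ^+ N * z).

Lemma integral_exp a N : integralOver iota (iota a ^+ N).
Proof. by rewrite -rmorphXn; apply: integral_id. Qed.

Lemma int_frac_id a : int_frac (iota a).
Proof. by exists 0%N; rewrite mul1r; apply: integral_id. Qed.

Lemma int_frac1 : int_frac 1.
Proof. by rewrite -(rmorph1 iota); apply: int_frac_id. Qed.

Lemma int_frac_add z w : int_frac z -> int_frac w -> int_frac (z + w).
Proof.
move=> [M iz] [N iw]; exists (M + N)%N; rewrite mulrDr exprD; apply: integral_add.
  by rewrite mulrAC mulrC; apply: integral_mul => //; apply: integral_exp.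
by rewrite -mulrA; apply: integral_mul => //; apply: integral_exp.
Qed.

Lemma int_frac_mul z w : int_frac z -> int_frac w -> int_frac (z * w).
Proof.
move=> [M iz] [N iw]; exists (M + N)%N.
by rewrite exprD mulrACA; apply: integral_mul.
Qed.

Lemma int_frac_opp z : int_frac z -> int_frac (- z).
Proof. by rewrite -mulN1r -(rmorphN1 iota); apply/int_frac_mul/int_frac_id. Qed.

Lemma int_frac_rmorph (sigma : {rmorphism K -> K}) z :
  (forall a, sigma (iota a) = iota a) -> int_frac z -> int_frac (sigma z).
Proof.
move=> fix_s [N [p mon_p pz0]]; exists N, p => //.
rewrite -(fix_s delta) -rmorphXn -rmorphM.
have -> : map_poly iota p = map_poly sigma (map_poly iota p).
  by rewrite -map_poly_comp; apply: eq_map_poly => a /=; rewrite fix_s.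
by apply: rmorph_root.
Qed.

(** Since x is 1 modulo c, it is coprime to c. Concretely, x y = c^(B+1) implies x (c^B - y t) =
    c^B, and the exponent descends to 0. *)
Lemma dvd_exp_unit (x y c t : P) B :
  x = 1 + c * t -> x * y = c ^+ B -> x \is a GRing.unit.
Proof.
move=> xE; elim: B y => [|B IH] y xy.
  by apply/unitrP; exists y; rewrite [y * x]mulrC xy expr0.
apply: (IH (c ^+ B - y * t)).
rewrite mulrBr mulrA xy exprSr {1}xE; ring.
Qed.

(* Multiplying the integral equation of delta^N u by (omega^n - kappa)^M turns
   it into a polynomial h over P with h(kappa) = 0 and h(omega^n) a power of
   delta; a minimal polynomial f of kappa divides h up to its leading
   coefficient a, so f(omega^n) divides a power of a delta.  The point omega is
   chosen so that f(omega^n) = f(0) G with G = 1 mod a delta, which makes G a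
   unit, against the choice of omega. *)
Lemma nonunit_value kappa n :
  has_nonunit_values P -> delta != 0 -> alg_over iota kappa -> kappa != 0 ->
  (0 < n)%N ->
  exists omega : P, forall u, int_frac u -> u * (iota omega ^+ n - kappa) <> 1.
Proof.
move=> hP delta0 alg_kappa kappa0 n_gt0.
have [f [f_neq0 fk fmin]] : exists f : {poly P}, [/\ f != 0, root (map_poly iota f) kappa
    & forall g, root (map_poly iota g) kappa -> (size g < size f)%N -> g = 0].
  pose Q m := `[< exists f : {poly P}, [/\ f != 0, root (map_poly iota f) kappa & size f = m] >].
  have exQ : exists m, Q m by case: alg_kappa => f f0 fk; exists (size f); apply/asboolP; exists f.
  case: (ex_minnP exQ) => m /asboolP[f [f0 fk <-]] hm; exists f; split => // g gk.
  by apply: contraTeq => g0; rewrite -leqNgt; apply/hm/asboolP; exists g.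
set a := lead_coef f; have a0 : a != 0 by rewrite lead_coef_eq0.
have [q fE] : exists q, f = q * 'X + (f.[0])%:P.
  have /factor_theorem[q qE] : root (f - (f.[0])%:P) 0 by rewrite rootE !hornerE subrr.
  by exists q; rewrite -[LHS](subrK (f.[0])%:P) qE subr0.
have q_neq0 : q != 0.
  apply: contraTneq fk => q0; rewrite fE q0 mul0r add0r map_polyC rootC iota_eq0 //.
  by apply: contra f_neq0 => /eqP c0; rewrite fE q0 c0 mul0r add0r polyC0.
have f0_neq0 : f.[0] != 0.
  apply: contra (q_neq0) => /eqP c0; apply/eqP/fmin.
    by move: fk; rewrite fE c0 addr0 rmorphM /= map_polyX rootM rootX (negPf kappa0) orbF.
  have -> : size f = (size q).+1 by rewrite fE c0 addr0 size_mulX.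
  by [].
set f0 := f.[0] in fE f0_neq0; set c := a * delta; set w := f0 * c.
have c_neq0 : c != 0 by rewrite mulf_neq0.
have w_neq0 : w != 0 by rewrite mulf_neq0.
have wE : w ^+ n = f0 * (c * w ^+ n.-1).
  by rewrite mulrA -/w -exprS prednK.
(* At (w l)^n the nonconstant part of f is divisible by w^n, hence by f0 c; T is the quotient as a
   polynomial in l. *)
pose T := (q \Po (w ^+ n *: 'X^n)) * ((w ^+ n.-1) *: 'X^n).
pose G := 1 + c *: T.
have wn_neq0 k : w ^+ k != 0 by rewrite expf_neq0.
have sT : (1 < size T)%N.
  have A_neq0 : q \Po (w ^+ n *: 'X^n) != 0.
    by rewrite comp_poly_eq0 // size_scale // size_polyXn.
  rewrite /T -scalerAr size_scale // size_mulXn //.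
  by apply: (leq_add n_gt0); rewrite size_poly_gt0.
have sG : (1 < size G)%N.
  by rewrite /G addrC size_polyDl size_scale // size_polyC oner_neq0.
have [l Gl] := hP G sG.
exists (w * l) => u [N [b mon_b bu]] uE; case/negP: Gl.
have [om omE] : exists om, om = (w * l) ^+ n by exists ((w * l) ^+ n).
set M := (size b).-1.
have GlE : f.[om] = f0 * G.[l].
  rewrite fE hornerMXaddC /G /T hornerD hornerC hornerZ hornerM horner_comp !hornerZ !hornerXn.
  rewrite omE exprMn wE; ring.
pose h := \sum_(i < M.+1) (b`_i * delta ^+ (N * i)) *: (om%:P - 'X) ^+ (M - i).
have hk : root (map_poly iota h) kappa.
  apply/rootP; rewrite rmorph_sum /= horner_sum.
  transitivity ((iota om - kappa) ^+ M * (map_poly iota b).[iota delta ^+ N * u]); last first.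
    by rewrite (rootP bu) mulr0.
  rewrite (@horner_coef_wide _ M.+1) ?size_map_inj_poly ?rmorph0 //; last by rewrite /M leqSpred.
  rewrite mulr_sumr; apply: eq_bigr => i _.
  rewrite map_polyZ rmorphXn rmorphB /= map_polyC map_polyX /= !hornerE coef_map /=.
  have hi : (i <= M)%N by rewrite -ltnS.
  have -> : (iota om - kappa) ^+ M = (iota om - kappa) ^+ (M - i) * (iota om - kappa) ^+ i.
    by rewrite -exprD subnK.
  have : (iota om - kappa) ^+ i * u ^+ i = 1.
    by rewrite -exprMn mulrC omE rmorphXn uE expr1n.
  rewrite rmorphM rmorphXn exprMn -exprM.
  set A1 := (iota om - kappa) ^+ i; set A2 := _ ^+ (M - i) => A1u.
  transitivity (iota b`_i * iota delta ^+ (N * i) * A2 * (A1 * u ^+ i)); first by rewrite A1u mulr1.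
  ring.
have hom : h.[om] = delta ^+ (N * M).
  rewrite horner_sum (bigD1 ord_max) //= subnn expr0 big1 => [|i].
    by rewrite addr0 hornerZ hornerC mulr1 -/M -lead_coefE (monicP mon_b) mul1r.
  rewrite -val_eqE /= => iM; rewrite hornerZ horner_exp hornerD hornerN hornerC hornerX subrr
    expr0n subn_eq0 leqNgt ltn_neqAle iM -ltnS ltn_ord mulr0 //.
have dv := Pdiv.Idomain.divp_eq h f.
have r0 : h %% f = 0.
  apply: fmin; last by rewrite ltn_modp.
  have : root (map_poly iota (lead_coef f ^+ scalp h f *: h)) kappa.
    by rewrite map_polyZ rootE hornerZ (rootP hk) mulr0.
  rewrite dv rmorphD rmorphM /= rootE hornerD hornerM (rootP fk) mulr0 add0r.
  by rewrite -rootE.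
have := congr1 (horner^~ om) dv; rewrite r0 addr0 hornerZ hornerM hom GlE -/a.
move=> Eq;
apply: (@dvd_exp_unit _ ((h %/ f).[om] * f0 * a ^+ (N * M) * delta ^+ scalp h f)
  c T.[l] (scalp h f + N * M)).
  by rewrite /G !hornerE.
rewrite /c exprMn !exprD.
transitivity ((h %/ f).[om] * (f0 * G.[l]) * (a ^+ (N * M) * delta ^+ scalp h f)); first by ring.
rewrite -Eq; ring.
Qed.

End IntegralFractions.

(** * The choice of the base ring P *)

Section BaseRing.
Variables (K : fieldType) (sigma : {rmorphism K -> K}).

Definition eval_at (B : idomainType) (j : {rmorphism B -> K}) (t : K) : {rmorphism {poly B} -> K} :=
  horner_eval t \o map_poly j.

Lemma eval_atE (B : idomainType) (j : {rmorphism B -> K}) t p :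
  eval_at j t p = (map_poly j p).[t].
Proof. by []. Qed.

Lemma alg_over_eval (B : idomainType) (j : {rmorphism B -> K}) t z :
  alg_over j z -> alg_over (eval_at j t) z.
Proof.
case=> p p0 pz; exists (map_poly polyC p); first by rewrite map_poly_eq0_id0
  // polyC_eq0 lead_coef_eq0.
rewrite -map_poly_comp (_ : map_poly _ p = map_poly j p) //.
by apply: eq_map_poly => a; rewrite /= /horner_eval map_polyC hornerC.
Qed.

(** Nonunit values serve to choose omega, and an infinite P to make generic choices. That sigma
    fixes P makes [int_frac] stable under sigma. *)
Definition good_base (P : idomainType) (iota : {rmorphism P -> K}) : Prop :=
  [/\ injective iota, has_nonunit_values P, exists f : nat -> P, injective f
    & forall a, sigma (iota a) = iota a].

(** The elements of l are treated one by one. A transcendental one replaces B by [{poly B}],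
    embedded by evaluation at that element, and polynomial rings always have nonunit values. If none
    occurs, everything is algebraic over the first B. *)
Lemma transcendence_dichotomy (l : seq K) (B : idomainType) (j : {rmorphism B -> K}) :
  injective j -> (forall b, sigma (j b) = j b) -> (forall z, z \in l -> sigma z = z) ->
  (forall z, z \in l -> alg_over j z) \/
  exists (P : idomainType) (iota : {rmorphism P -> K}),
    [/\ good_base iota, forall z, alg_over j z -> alg_over iota z
      & forall z, z \in l -> alg_over iota z].
Proof.
elim: l B j => [|r l IH] B j j_inj fix_j fix_l; first by left.
have fix_l' z : z \in l -> sigma z = z by move=> zl; apply: fix_l; rewrite in_cons zl orbT.
have [r_alg|r_trans] := pselect (alg_over j r).
  case: (IH B j j_inj fix_j fix_l') => [l_alg|[P [iota [good_i up l_alg]]]].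
    by left=> z; rewrite in_cons => /predU1P[->|/l_alg].
  right; exists P, iota; split=> // z; rewrite in_cons => /predU1P[->|/l_alg] //.
  exact: up.
right; pose j' := eval_at j r.
have j'_inj : injective j'.
  apply: raddf_inj => p pr0; apply: contrapT => /eqP p0; apply: r_trans.
  by exists p => //; apply/rootP.
have fix_j' p : sigma (j' p) = j' p.
  rewrite /j' eval_atE -horner_map fix_l ?mem_head // -map_poly_comp; congr (_.[_]).
  by apply: eq_map_poly => b /=; rewrite fix_j.
have alg_r : alg_over j' r.
  exists ('X - ('X)%:P); first by rewrite polyXsubC_eq0.
  by rewrite rmorphB /= map_polyX map_polyC /= root_XsubC /horner_eval map_polyX hornerX.
case: (IH _ j' j'_inj fix_j' fix_l') => [l_alg|[P [iota [good_i up l_alg]]]].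
  exists {poly B}, j'; split => //.
  - split=> //; first exact: poly_nonunit_values.
    exists (fun i => 'X^i) => i k /(congr1 (fun p : {poly B} => size p)).
    by rewrite !size_polyXn => -[].
  - by move=> z; apply: alg_over_eval.
  - by move=> z; rewrite in_cons => /predU1P[->|/l_alg].
exists P, iota; split=> //.
- by move=> z jz; apply/up/alg_over_eval.
- by move=> z; rewrite in_cons => /predU1P[->|/l_alg] //; apply: up.
Qed.

Section PrimeChar.
Variables (p : nat) (charKp : p \in [pchar K]).
Definition of_Fp : {rmorphism 'F_p -> K} :=
  let f : {rmorphism 'F_p -> pPrimeCharType charKp} := GRing.in_alg (pPrimeCharType charKp) in f.

Lemma of_Fp_fixed a : sigma (of_Fp a) = of_Fp a.
Proof.
have pr_p := pcharf_prime charKp.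
have -> : a = (val a)%:R by rewrite natr_Zp.
by rewrite !rmorph_nat.
Qed.

(* The powers of z take finitely many values, so z is 0 or a root of unity. *)
Lemma alg_Fp_root_of_unity z : alg_over of_Fp z -> z != 0 -> exists2 k, (0 < k)%N & z ^+ k = 1.
Proof.
case=> f f0 /rootP fz z0.
pose d := size f.
pose r (i : 'I_(#|'rV['F_p]_d|.+1)) : 'rV['F_p]_d := poly_rV ('X^i %% f).
have [i [k ik rik]] : exists i, exists2 k, i != k & r i = r k.
  apply: contrapT => H; have r_inj : injective r.
    move=> i k rik; apply: contrapT => /eqP ik; apply: H; exists i; by exists k.
  by have := leq_card r r_inj; rewrite card_ord ltnn.
have E m : z ^+ m = (map_poly of_Fp ('X^m %% f)).[z].
  rewrite -[LHS]hornerXn -(map_polyXn of_Fp) {1}(divp_eq 'X^m f).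
  by rewrite rmorphD rmorphM hornerD hornerM fz mulr0 add0r.
have Ezz : z ^+ i = z ^+ k.
  have sz m : (size ('X^m %% f)%R <= d)%N by rewrite ltnW // ltn_modp.
  by rewrite !E -(poly_rV_K (sz i)) -(poly_rV_K (sz k)) -/(r i) -/(r k) rik.
wlog lt_ik : i k ik rik Ezz / (i < k)%N.
  move=> W; have := ik; rewrite -val_eqE neq_ltn => /orP[h|h]; first exact: (W i k).
  by apply: (W k i) => //; rewrite eq_sym.
exists (k - i)%N; first by rewrite subn_gt0.
apply: (mulfI (expf_neq0 i z0)).
by rewrite mulr1 -exprD subnKC // ltnW.
Qed.

(** A nonzero z is a root of unity, and injectivity of Frobenius removes the factors p from the
    exponent. Euler's theorem then gives a power of p that is 1 modulo the remaining k'. *)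
Lemma alg_Fp_frobenius z : alg_over of_Fp z -> exists2 f, (0 < f)%N & z ^+ (p ^ f) = z.
Proof.
move=> alg_z; have pr_p := pcharf_prime charKp.
have [->|z0] := eqVneq z 0.
  by exists 1%N => //; rewrite expr0n expn1 -leqn0 leqNgt prime_gt0.
have [k k_gt0 zk] := alg_Fp_root_of_unity alg_z z0.
have := pfactor_coprime pr_p k_gt0 => -[k' co_pk' kE].
have zk' : z ^+ k' = 1.
  apply/eqP; rewrite -subr_eq0; move: zk; rewrite kE exprM => /eqP.
  rewrite -subr_eq0; set e := logn p k.
  elim: e => [|e IH]; first by rewrite expr1.
  rewrite expnSr exprM.
  have -> : (z ^+ k' ^+ (p ^ e)) ^+ p - 1 = (z ^+ k' ^+ (p ^ e) - 1) ^+ p.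
    by rewrite -!(pFrobenius_autE charKp) rmorphB rmorph1.
  by rewrite expf_eq0 prime_gt0 //.
have k'_gt0 : (0 < k')%N by move: k_gt0; rewrite kE muln_gt0 => /andP[].
exists (totient k'); first by rewrite totient_gt0.
have /eqP := Euler_exp_totient co_pk'.
(* For k' = 1 the residue of 1 modulo k' is 0, so this case, where z = 1, is treated apart. *)
have [k'1|k'1] := leqP k' 1.
  have k'E : k' = 1%N by apply/eqP; rewrite eqn_leq k'1.
  by move=> _; move: zk'; rewrite k'E expr1 => ->; rewrite expr1n.
rewrite (modn_small k'1) => /eqP E.
by rewrite (divn_eq (p ^ totient k') k') E exprD mulnC exprM zk' expr1n mul1r expr1.
Qed.
End PrimeChar.

(** The dichotomy is started from the prime ring. In characteristic 0 the integers are a good base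
    themselves, so the exceptional case only concerns a finite prime field. *)
Lemma base_ring (l : seq K) : (forall z, z \in l -> sigma z = z) ->
  (exists (p : nat) (charKp : p \in [pchar K]), forall z, z \in l -> alg_over (of_Fp charKp) z) \/
  exists (P : idomainType) (iota : {rmorphism P -> K}),
    good_base iota /\ forall z, z \in l -> alg_over iota z.
Proof.
move=> fix_l; have [[p charKp]|char0] := pselect (exists p, p \in [pchar K]).
  case: (@transcendence_dichotomy l 'F_p (of_Fp charKp)) => //.
  - exact: fmorph_inj.
  - exact: of_Fp_fixed.
  - by left; exists p, charKp.
  - by move=> [P [iota [gi _ il]]]; right; exists P, iota.
right.
have j_inj : injective (intmul 1 : {rmorphism int -> K}).
  apply: raddf_inj => n /eqP; apply: contraTeq => n0.
  have := pcharf0P K => -[+ _]; move=> /(_ _) c0.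
  have {}c0 : forall m, (m%:R == 0 :> K) = (m == 0%N).
    by apply: c0 => m; apply/negP => cm; apply: char0; exists m.
  by case: n n0 => n; rewrite ?NegzE /= ?rmorphN /= ?oppr_eq0 -?pmulrn c0.
case: (@transcendence_dichotomy l int (intmul 1)) => //.
- by move=> b; rewrite rmorph_int.
- move=> il; exists int, (intmul 1); split=> //; split=> //.
  + exact: int_nonunit_values.
  + by exists Posz => i k [].
  + by move=> b; rewrite rmorph_int.
- by move=> [P [iota [gi _ il]]]; exists P, iota.
Qed.
End BaseRing.

(** * The trace of sigma and generic elements of K *)

Section IterMorphism.
Variables (K : fieldType) (sigma : {rmorphism K -> K}).

Lemma iter_rmorphM i (a b : K) : iter i sigma (a * b) = iter i sigma a * iter i sigma b.
Proof. by elim: i => //= i ->; rewrite rmorphM. Qed.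

Lemma iter_rmorphD i (a b : K) : iter i sigma (a + b) = iter i sigma a + iter i sigma b.
Proof. by elim: i => //= i ->; rewrite rmorphD. Qed.

Lemma iter_rmorph1 i : iter i sigma 1 = 1.
Proof. by elim: i => //= i ->; rewrite rmorph1. Qed.

Lemma iter_rmorphN i (a : K) : iter i sigma (- a) = - iter i sigma a.
Proof. by elim: i => //= i ->; rewrite rmorphN. Qed.

Lemma iter_rmorphV i (a : K) : iter i sigma a^-1 = (iter i sigma a)^-1.
Proof. by elim: i => //= i ->; rewrite fmorphV. Qed.

Lemma iter_rmorph_eq0 i (a : K) : (iter i sigma a == 0) = (a == 0).
Proof. by elim: i => //= i <-; rewrite fmorph_eq0. Qed.

Lemma iter_rmorph_inj i : injective (iter i sigma).
Proof. by elim: i => //= i IH a b /fmorph_inj/IH. Qed.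

Lemma iter_fixed i (a : K) : sigma a = a -> iter i sigma a = a.
Proof. by move=> sa; elim: i => //= i ->. Qed.

Definition del k := k - sigma k.

Lemma delM u k : sigma u = u -> del (u * k) = u * del k.
Proof. by move=> su; rewrite /del rmorphM su mulrBr. Qed.

Lemma del_eq0 k : (del k == 0) = (sigma k == k).
Proof. by rewrite subr_eq0 eq_sym. Qed.

Lemma delV_eq0 k : (del k^-1 == 0) = (del k == 0).
Proof. by rewrite !del_eq0 fmorphV (inj_eq invr_inj). Qed.

Variable n : nat.
Hypothesis n_gt0 : (0 < n)%N.

Definition trace (k : K) : K := \sum_(i < n) iter i sigma k.

(** This is [trace (d^-1 * (z * s th))], where s is the action of [start d] given by [acts_start]:
    the form that arises when the rank one inverse of [start d] is followed on its right by z and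
    [start d]. *)
Definition Psi (z b d th : K) : K := trace (z * del (b * del (d^-1 * th))).

Lemma traceM u k : sigma u = u -> trace (u * k) = u * trace k.
Proof.
by move=> su; rewrite mulr_sumr; apply: eq_bigr => i _; rewrite iter_rmorphM iter_fixed.
Qed.

Lemma traceB a b : trace (a - b) = trace a - trace b.
Proof.
by rewrite -sumrB; apply: eq_bigr => i _ /=; rewrite iter_rmorphD iter_rmorphN.
Qed.

Hypothesis sigma_n : forall k, iter n sigma k = k.

Lemma trace_shift k : trace (sigma k) = trace k.
Proof.
apply/eqP; rewrite -subr_eq0 /trace -sumrB.
rewrite (eq_bigr (fun i : 'I_n => iter i.+1 sigma k - iter i sigma k)); last first.
  by move=> i _; rewrite iterSr.
by rewrite -(big_mkord xpredT (fun i => iter i.+1 sigma k - iter i sigma k))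
  telescope_sumr // sigma_n subrr.
Qed.

Lemma trace_fixed k : sigma (trace k) = trace k.
Proof. by rewrite -[RHS]trace_shift /trace rmorph_sum; apply: eq_bigr => i _; rewrite -iterS iterSr. Qed.

(** When sigma has order dividing n, [iter n.-1 sigma] is its inverse, and multiplication by [adj z]
    is what remains of z after [del] is moved across the trace. *)
Definition adj (z : K) := z - iter n.-1 sigma z.

Lemma adj_neq0 z : sigma z != z -> adj z != 0.
Proof.
apply: contraNneq => /eqP; rewrite subr_eq0 => /eqP zE.
by rewrite {1}zE -iterS prednK // sigma_n.
Qed.

(** This writes Psi as [trace (b * m)] with m independent of b, the shape required by the generic
    choice of b. *)
Lemma PsiE z b d th : Psi z b d th = trace (b * (adj z * del (d^-1 * th))).
Proof.
rewrite /Psi; set w := del (d^-1 * th).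
have -> : z * del (b * w) = z * b * w - sigma (iter n.-1 sigma z * (b * w)).
  by rewrite rmorphM -iterS prednK // sigma_n /del; ring.
by rewrite traceB trace_shift -traceB /adj; congr trace; ring.
Qed.

Variable x : K.
Hypothesis x_orbit : forall i, (0 < i < n)%N -> iter i sigma x <> x.

Lemma orbit_neq (i k : 'I_n) : i != k -> iter i sigma x != iter k sigma x.
Proof.
wlog lt_ik : i k / (i < k)%N.
  move=> W ik; have := ik; rewrite -val_eqE neq_ltn => /orP[h|h]; first exact: W.
  by rewrite eq_sym; apply: W => //; rewrite eq_sym.
move=> _; rewrite -(subnKC (ltnW lt_ik)) iterD.
rewrite (inj_eq (@iter_rmorph_inj _)) eq_sym; apply/eqP/x_orbit.
by rewrite subn_gt0 lt_ik (leq_ltn_trans (leq_subr _ _)).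
Qed.

Hypotheses (x_neq0 : x != 0) (n_gt1 : (1 < n)%N).

Lemma x_moved : sigma x != x.
Proof. by apply/eqP; have := @x_orbit 1 n_gt1. Qed.

Lemma fixed_mulx_neq1 u : sigma u = u -> 1 - u * x != 0.
Proof.
move=> su; rewrite subr_eq0 eq_sym; apply: contraNneq x_moved => ux.
have u0 : u != 0 by apply: contra_eq_neq ux => ->; rewrite mul0r eq_sym oner_eq0.
by rewrite -(inj_eq (mulfI u0)) -{1}su -rmorphM ux rmorph1.
Qed.

(* The numerator of trace (m / (1 - u x)), as a polynomial in u, does not vanish
   at u = 1 / x. *)
Lemma generic_trace m : m != 0 -> exists2 q : {poly K}, q != 0 &
  forall u, sigma u = u -> q.[u] != 0 -> trace (m / (1 - u * x)) != 0.
Proof.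
move=> m0.
pose F (i : 'I_n) : {poly K} := \prod_(k < n | k != i) (1 - iter k sigma x *: 'X).
pose q := \sum_(i < n) iter i sigma m *: F i.
have linE c u : (1 - c *: 'X).[u] = 1 - c * u :> K by rewrite !hornerE.
exists q.
  have : q.[x^-1] != 0.
    rewrite horner_sum (bigD1 (Ordinal n_gt0)) //= big1 ?addr0 => [|i i0].
      rewrite hornerZ mulf_neq0 // horner_prod; apply/prodf_neq0 => k k0.
      rewrite linE subr_eq0 eq_sym -(inj_eq (mulIf x_neq0)) mulfVK // mul1r.
      exact: (@orbit_neq k (Ordinal n_gt0)).
    rewrite hornerZ horner_prod (bigD1 (Ordinal n_gt0)) ?(eq_sym _ i) //=.
    by rewrite linE mulfV // subrr mul0r mulr0.
  by apply: contraNneq => ->; rewrite horner0.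
move=> u su; apply: contraNneq => t0.
have nz k : 1 - u * iter k sigma x != 0.
  have -> : 1 - u * iter k sigma x = iter k sigma (1 - u * x).
    by rewrite iter_rmorphD iter_rmorph1 iter_rmorphN iter_rmorphM (iter_fixed _ su).
  by rewrite iter_rmorph_eq0 fixed_mulx_neq1.
apply/eqP; rewrite -[RHS](mul0r (\prod_(k < n) (1 - u * iter k sigma x))) -t0 mulr_suml horner_sum.
apply: eq_bigr => i _; rewrite hornerZ iter_rmorphM iter_rmorphV -mulrA; congr (_ * _).
rewrite (bigD1 i) //= iter_rmorphD iter_rmorph1 iter_rmorphN iter_rmorphM (iter_fixed _ su).
rewrite mulKf // horner_prod; apply: eq_bigr => k _.
by rewrite linE mulrC.
Qed.

Lemma generic_traces (ms : seq K) : 0 \notin ms -> exists2 q : {poly K}, q != 0 &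
  forall u, sigma u = u -> q.[u] != 0 -> forall m, m \in ms -> trace (m / (1 - u * x)) != 0.
Proof.
elim: ms => [|m ms IH]; first by exists 1; rewrite ?oner_neq0.
rewrite in_cons negb_or eq_sym => /andP[m0 /IH[q q0 qP]].
have [p p0 pP] := generic_trace m0.
exists (p * q); first by rewrite mulf_neq0.
move=> u su; rewrite hornerM mulf_eq0 negb_or => /andP[pu qu] k.
by rewrite in_cons => /predU1P[->|/qP]; [exact: pP | exact].
Qed.

Lemma del_x_neq0 : del x != 0. Proof. by rewrite del_eq0 x_moved. Qed.

Section GenericData.
Variables (P : idomainType) (iota : {rmorphism P -> K}).
Hypothesis base : good_base sigma iota.
Hypothesis alg_x : alg_over iota x.

Lemma base_nonroot (q : {poly K}) : q != 0 -> exists a, q.[iota a] != 0.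
Proof.
have [i_inj _ [f f_inj] _] := base => q0.
have [i qi] := poly_nonroot (inj_comp i_inj f_inj) q0.
by exists (f i).
Qed.

Lemma generic_theta : exists theta, [/\ theta != 0, alg_over iota theta, del theta != 0,
  del (theta * x) != 0 & del (theta / x) != 0].
Proof.
have [i_inj _ _ i_fix] := base.
(* For theta = u + x, [del (theta * x)] is [del x] times u + x + sigma x, and [del (theta / x)]
   vanishes only with u. The polynomial collects these two conditions on u. *)
have q0 : 'X * ('X + (x + sigma x)%:P) != 0 :> {poly K}.
  by rewrite mulf_neq0 ?polyX_eq0 // -[x + _]opprK polyCN polyXsubC_eq0.
have [a] := base_nonroot q0; rewrite !hornerE mulf_eq0 negb_or => /andP[u0 ux].
set u := iota a in u0 ux; have su : sigma u = u by apply: i_fix.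
have sx0 : sigma x != 0 by rewrite fmorph_eq0.
have dx := del_x_neq0.
exists (u + x); split.
- apply: contraNneq x_moved => /eqP; rewrite addrC addr_eq0 => /eqP ->.
  by rewrite rmorphN su.
- by apply: alg_add => //; apply: alg_id.
- by have -> : del (u + x) = del x by rewrite /del rmorphD su; ring.
- have -> : del ((u + x) * x) = del x * (u + (x + sigma x)).
    by rewrite /del !(rmorphD, rmorphM) su; ring.
  by rewrite mulf_neq0 // addrA.
have -> : del ((u + x) / x) = - del x * u / (x * sigma x).
  by rewrite /del rmorphM rmorphD fmorphV su; field; rewrite sx0 x_neq0.
by rewrite !mulf_neq0 ?oppr_eq0 ?invr_neq0 ?mulf_neq0.
Qed.

(** The inverse of b is sought as beta (1 - u x) with beta of nonzero trace. Its trace is affine in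
    u with value [trace beta] at 0, and each [trace (b * m)] has the form handled by
    [generic_traces]. *)
Lemma generic_b (ms : seq K) : 0 \notin ms ->
  exists b, [/\ b != 0, alg_over iota b, trace b^-1 != 0
    & forall m, m \in ms -> trace (b * m) != 0].
Proof.
have [i_inj _ _ i_fix] := base => ms0.
have linE c c' u : (c%:P - c' *: 'X).[u] = c - c' * u :> K by rewrite !hornerE.
have alg_1ux a : alg_over iota (1 - iota a * x).
  rewrite -(rmorph1 iota); apply: alg_add (alg_id _ _) _ => //.
  by apply/alg_opp/alg_mul => //; apply: alg_id.
have [q1 q10 q1P] := generic_trace (oner_neq0 K).
have [a1 a1q] := base_nonroot q10.
have := q1P _ (i_fix a1) a1q; rewrite mul1r; set beta := _^-1 => tb.
have beta0 : beta != 0 by rewrite invr_neq0 // fixed_mulx_neq1.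
have [q2 q20 q2P] : exists2 q : {poly K}, q != 0 &
  forall u, sigma u = u -> q.[u] != 0 ->
    forall m, m \in [seq m / beta | m <- ms] -> trace (m / (1 - u * x)) != 0.
  apply: generic_traces; apply/mapP => -[m mms /esym/eqP].
  by rewrite mulf_eq0 invr_eq0 (negPf beta0) orbF => /eqP m0; rewrite -m0 mms in ms0.
pose q3 := (trace beta)%:P - trace (beta * x) *: 'X.
have q30 : q3 != 0.
  apply: contraNneq tb => /(congr1 (fun q => q.[0])).
  by rewrite linE mulr0 subr0 horner0 => ->.
have [a] := base_nonroot (mulf_neq0 q20 q30); rewrite hornerM mulf_eq0 negb_or => /andP[aq2 aq3].
set u := iota a in aq2 aq3; have su : sigma u = u by apply: i_fix.
have u1 := fixed_mulx_neq1 su.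
exists (beta * (1 - u * x))^-1; split.
- by rewrite invr_neq0 // mulf_neq0.
- by apply: alg_inv => //; apply: alg_mul => //; [apply: alg_inv => //|]; exact: alg_1ux.
- rewrite invrK (_ : _ * _ = beta - u * (beta * x)); last by ring.
  by move: aq3; rewrite traceB traceM // linE mulrC.
move=> m mms; rewrite (_ : _ * m = m / beta / (1 - u * x)); last first.
  by rewrite invfM [_ / _ * m]mulrC mulrA.
by apply: q2P => //; apply: map_f.
Qed.

(** The two conjugators are theta and 1. By [PsiE] every condition on Psi says that
    [trace (b * (adj z * del g))] is nonzero, where g is one of the quotients listed in [gs]. *)
Lemma generic_data : exists b (d : bool -> K), [/\ b != 0, alg_over iota b, trace b^-1 != 0,
  forall i, d i != 0 /\ alg_over iota (d i)
  & [/\ forall i, Psi x b (d i) (x * d i) != 0, forall i, Psi x b (d i) (x^-1 * d i) != 0,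
      forall i k, Psi x^-1 b (d i) (x * d k) != 0, forall i k, Psi x^-1 b (d i) (x^-1 * d k) != 0
      & forall i k, i != k -> Psi x^-1 b (d i) (d k) != 0]].
Proof.
have [theta [th0 alg_th dth dthx dthVx]] := generic_theta.
pose d (i : bool) := if i then theta else 1.
have d0 i : d i != 0 by case: i; rewrite ?oner_neq0.
pose zs := [:: x; x^-1].
pose gs := [:: x; x^-1; theta; theta^-1; theta * x; theta / x; (theta * x)^-1; (theta / x)^-1].
have gs0 g : g \in gs -> del g != 0.
  by rewrite !inE => /or4P[/eqP->|/eqP->|/eqP->|/or4P[|||/orP[]]/eqP->]; rewrite ?delV_eq0 // del_x_neq0.
have zs0 z : z \in zs -> adj z != 0.
  by rewrite !inE => /orP[]/eqP->; apply: adj_neq0; rewrite ?fmorphV ?(inj_eq invr_inj) x_moved.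
have [|b [b0 alg_b tb bP]] := @generic_b [seq adj z * del g | z <- zs, g <- gs].
  apply/allpairsP => -[[z g] /= [zz gg /esym/eqP]].
  by rewrite mulf_eq0 (negPf (zs0 _ zz)) (negPf (gs0 _ gg)).
have bPsi z i k w : z \in zs -> (d i)^-1 * (w * d k) \in gs -> Psi z b (d i) (w * d k) != 0.
  by move=> zz gg; rewrite PsiE; apply/bP/allpairsP; exists (z, (d i)^-1 * (w * d k)).
have xz : x \in zs by rewrite mem_head.
have xVz : x^-1 \in zs by rewrite !inE eqxx orbT.
have [i_inj _ _ _] := base.
have alg1 : alg_over iota 1 by rewrite -(rmorph1 iota); exact: alg_id.
exists b, d; split=> //; first by move=> i; split; rewrite ?d0 //; case: i.
have g1 i k : (d i)^-1 * (x * d k) \in gs.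
  have -> : (d i)^-1 * (x * d k) = if i == k then x else if i then (theta / x)^-1 else theta * x.
    by case: i k => [] [] /=; rewrite ?invr1 ?invf_div; field.
  by case: (i == k); case: i; rewrite !inE eqxx ?orbT.
have g2 i k : (d i)^-1 * (x^-1 * d k) \in gs.
  have -> : (d i)^-1 * (x^-1 * d k) = if i == k then x^-1 else if i then (theta * x)^-1 else theta / x.
    by case: i k => [] [] /=; rewrite ?invr1; field; rewrite ?x_neq0.
  by case: (i == k); case: i; rewrite !inE eqxx ?orbT.
split=> [i|i|i k|i k|i k ik]; [exact: bPsi|exact: bPsi|exact: bPsi|exact: bPsi|].
rewrite PsiE; apply/bP/allpairsP; exists (x^-1, (d i)^-1 * d k); split=> //=.
by case: i k ik => [] [] //= _; rewrite ?invr1 ?mulr1 ?mul1r !inE eqxx ?orbT.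
Qed.
End GenericData.
End IterMorphism.

(** * Twisted polynomials and their rank one action modulo eps *)

Section TwistedPolynomials.
Variables (D : unitRingType) (K : fieldType) (v : {rmorphism K -> D}).
Variables (sigma : {rmorphism K -> K}) (Y : D) (n : nat) (e : K).
Hypothesis Yv : forall k, Y * v k = v (sigma k) * Y.
Hypothesis n_gt0 : (0 < n)%N.
Hypothesis Yn : Y ^+ n = v e.

Lemma YXv i k : Y ^+ i * v k = v (iter i sigma k) * Y ^+ i.
Proof.
elim: i => [|i IH]; first by rewrite mulr1 mul1r.
by rewrite exprS -mulrA IH mulrA Yv iterS mulrA.
Qed.

Variable R : K -> Prop.
Hypotheses (R1 : R 1) (RB : forall a b, R a -> R b -> R (a - b))
  (RM : forall a b, R a -> R b -> R (a * b)) (Rsigma : forall a, R a -> R (sigma a))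
  (Re : R e).

Lemma R0 : R 0. Proof. by rewrite -(subrr 1); apply: RB. Qed.
Lemma RN a : R a -> R (- a). Proof. by rewrite -sub0r; apply/RB/R0. Qed.
Lemma RD a b : R a -> R b -> R (a + b).
Proof. by move=> ra rb; rewrite -[b]opprK; apply/RB/RN. Qed.
Lemma Riter i a : R a -> R (iter i sigma a).
Proof. by move=> ra; elim: i => //= i; apply: Rsigma. Qed.
Lemma RX i a : R a -> R (a ^+ i).
Proof. by move=> ra; elim: i => // i IH; rewrite exprS; apply: RM. Qed.
Lemma Rsum (I : Type) (r : seq I) (Q : pred I) (F : I -> K) :
  (forall i, R (F i)) -> R (\sum_(i <- r | Q i) F i).
Proof. by move=> H; apply: big_ind => // [|a b]; [exact: R0|exact: RD]. Qed.

(** The order R[Y]. Exponents below n suffice because Y^n = [v e] with e in R. *)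
Definition lam (z : D) : Prop :=
  exists r : 'I_n -> K, (forall i, R (r i)) /\ z = \sum_i v (r i) * Y ^+ i.

Lemma lamD z w : lam z -> lam w -> lam (z + w).
Proof.
move=> [r [Rr ->]] [s [Rs ->]]; exists (fun i => r i + s i); split=> [i|]; first exact: RD.
by rewrite -big_split; apply: eq_bigr => i _; rewrite rmorphD mulrDl.
Qed.

Lemma lam_v a : R a -> lam (v a).
Proof.
move=> Ra; exists (fun i => if val i == 0%N then a else 0); split=> [i|].
  by case: ifP => // _; apply: R0.
rewrite (bigD1 (Ordinal n_gt0)) //= mulr1 big1 ?addr0 // => i.
by rewrite -val_eqE /= => /negPf ->; rewrite rmorph0 mul0r.
Qed.

Lemma lam_vl a z : R a -> lam z -> lam (v a * z).
Proof.
move=> Ra [r [Rr ->]]; exists (fun i => a * r i); split=> [i|]; first exact: RM.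
by rewrite mulr_sumr; apply: eq_bigr => i _; rewrite rmorphM mulrA.
Qed.

Lemma lamN z : lam z -> lam (- z).
Proof. by rewrite -mulN1r -(rmorphN1 v); apply/lam_vl/RN. Qed.

Lemma lamB z w : lam z -> lam w -> lam (z - w).
Proof. by move=> lz lw; apply/lamD/lamN. Qed.

Lemma lam_vr a z : R a -> lam z -> lam (z * v a).
Proof.
move=> Ra [r [Rr ->]]; exists (fun i => r i * iter i sigma a).
split=> [i|]; first by apply/RM/Riter.
by rewrite mulr_suml; apply: eq_bigr => i _; rewrite rmorphM -!mulrA YXv.
Qed.

Lemma lamYr z : lam z -> lam (z * Y).
Proof.
(* Coefficients are shifted cyclically by [ord_pred]; the one that wraps around to exponent 0 picks
   up Y^n = [v e]. *)
move=> [r [Rr ->]]; pose w (i : 'I_n) := if val i == 0%N then e else 1.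
exists (fun i => r (ord_pred i) * w i); split=> [i|].
  by apply: RM => //; rewrite /w; case: ifP.
rewrite mulr_suml (reindex_inj (can_inj (@ord_predK n))); apply: eq_bigr => i _.
rewrite -mulrA -exprSr rmorphM -mulrA; congr (_ * _).
rewrite /w; have [i0|i_gt0] := posnP (val i).
  by rewrite /= i0 /= expr0 mulr1 add0n modn_small ?prednK.
rewrite /= rmorph1 mul1r; congr (_ ^+ _).
have -> : (i + n).-1 = (i.-1 + n)%N by rewrite -[in LHS](prednK i_gt0) addSn.
rewrite modnDr modn_small; first by rewrite prednK.
exact: leq_ltn_trans (leq_pred _) (ltn_ord i).
Qed.

Lemma lam0 : lam 0. Proof. by rewrite -(rmorph0 v); apply/lam_v/R0. Qed.
Lemma lam1 : lam 1. Proof. by rewrite -(rmorph1 v); apply/lam_v. Qed.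

Lemma lamM z w : lam z -> lam w -> lam (z * w).
Proof.
move=> lz [r [Rr ->]]; rewrite mulr_sumr; apply: big_ind => [||i _].
- exact: lam0.
- exact: lamD.
rewrite mulrA; elim: (nat_of_ord i) => [|k IH]; first by rewrite mulr1; apply: lam_vr.
by rewrite exprSr mulrA; apply: lamYr.
Qed.

Lemma lamX i z : lam z -> lam (z ^+ i).
Proof.
by move=> lz; elim: i => [|i IH]; [exact: lam1 | rewrite exprS; apply: lamM].
Qed.

Lemma lamY : lam Y. Proof. by rewrite -[Y]mul1r; apply/lamYr/lam1. Qed.

Section Independence.
Variable x : K.
Hypothesis x_orbit : forall i, (0 < i < n)%N -> iter i sigma x <> x.

Hypothesis Y_unit : Y \is a GRing.unit.

(* Right multiplication by powers of x scales the coefficients r i by powers of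
   the distinct elements sigma^i x; a Lagrange polynomial isolates each r i. *)
Lemma Y_independent (r : 'I_n -> K) :
  \sum_i v (r i) * Y ^+ i = 0 -> forall i, r i = 0.
Proof.
move=> r0 i0.
have rp (p : {poly K}) : \sum_i v (r i * p.[iter i sigma x]) * Y ^+ i = 0.
  transitivity (\sum_(j < size p) v p`_j * ((\sum_i v (r i) * Y ^+ i) * v (x ^+ j))).
    rewrite (eq_bigr (fun i => \sum_(j < size p) v p`_j * (v (r i) * Y ^+ i * v (x ^+ j)))).
      by rewrite exchange_big; apply: eq_bigr => j _; rewrite mulr_suml mulr_sumr.
    move=> i _; rewrite horner_coef mulr_sumr rmorph_sum mulr_suml; apply: eq_bigr => j _.
    rewrite -[v (r i) * _ * _]mulrA YXv !mulrA -!rmorphM; congr (v _ * _).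
    rewrite [r i * _]mulrC; congr (_ * _); elim: (nat_of_ord j) => [|k IH].
      by rewrite !expr0 iter_rmorph1.
    by rewrite !exprS iter_rmorphM IH.
  by rewrite big1 // => j _; rewrite r0 mul0r mulr0.
pose q : {poly K} := \prod_(k | k != i0) ('X - (iter k sigma x)%:P).
have := rp q; rewrite (bigD1 i0) //= [X in _ + X]big1 => [|k ki0]; last first.
  rewrite (_ : q.[_] = 0) ?mulr0 ?rmorph0 ?mul0r //.
  by rewrite horner_prod (bigD1 k) //= hornerXsubC subrr mul0r.
rewrite addr0 => /(congr1 (fun z => z * (Y ^+ i0)^-1)); rewrite mul0r mulrK ?unitrX //.
rewrite -(rmorph0 v) => /fmorph_inj/eqP; rewrite mulf_eq0 => /orP[/eqP //|].
rewrite horner_prod prodf_seq_eq0 => /hasP[k _ /andP[ki0]].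
by rewrite hornerXsubC subr_eq0 eq_sym (negPf (orbit_neq x_orbit ki0)).
Qed.

(** Y^n lies in the commutative image of K, so conjugation by it is trivial there. *)
Lemma iter_n_id k : iter n sigma k = k.
Proof.
apply: (fmorph_inj v); apply: (@mulIr _ (Y ^+ n)); first exact: unitrX.
by rewrite -YXv Yn -!rmorphM mulrC.
Qed.

Local Notation tr := (trace sigma n).
Local Notation del := (del sigma).
Local Notation Psi := (Psi sigma n).
Let trM := @traceM _ sigma n.
Let tr_fixed := trace_fixed iter_n_id.

Lemma R_tr k : R k -> R (tr k).
Proof. by move=> Rk; apply: Rsum => i; apply: Riter. Qed.

Section RankOne.
Variable eps : K.
Hypotheses (eE : e = 1 - eps) (Reps : R eps) (eps_fixed : sigma eps = eps).
Hypothesis eps_nonunit : forall u, R u -> u * eps <> 1.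

Definition tau : D := \sum_(i < n) Y ^+ i.

Lemma lam_sumY (I : Type) (r : seq I) (F : I -> D) :
  (forall i, lam (F i)) -> lam (\sum_(i <- r) F i).
Proof. by move=> H; apply: big_ind => // [|z w]; [exact: lam0|exact: lamD]. Qed.

Lemma lam_tau : lam tau.
Proof. by apply: lam_sumY => i; apply/lamX/lamY. Qed.

Lemma mul_1Y_tau : (1 - Y) * tau = v eps.
Proof. by rewrite -opprB mulNr -subrX1 Yn eE rmorphB rmorph1 opprB opprB addrC subrK. Qed.

Definition eqe (z w : D) : Prop := exists2 t, lam t & z - w = v eps * t.

Lemma eqe_refl z : eqe z z.
Proof. by exists 0; [exact: lam0 | rewrite subrr mulr0]. Qed.

Lemma eqe_trans z w t : eqe z w -> eqe w t -> eqe z t.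
Proof.
move=> [a la Ea] [b lb Eb]; exists (a + b); first exact: lamD.
by rewrite mulrDr -Ea -Eb addrA subrK.
Qed.

Lemma eqeD z w z' w' : eqe z w -> eqe z' w' -> eqe (z + z') (w + w').
Proof.
move=> [a la Ea] [b lb Eb]; exists (a + b); first exact: lamD.
by rewrite mulrDr -Ea -Eb opprD addrACA.
Qed.

Lemma eqe_sum (I : Type) (r : seq I) (F G : I -> D) :
  (forall i, eqe (F i) (G i)) -> eqe (\sum_(i <- r) F i) (\sum_(i <- r) G i).
Proof.
by move=> H; apply: (big_ind2 eqe) => // [|z w z' w']; [exact: eqe_refl|exact: eqeD].
Qed.

Lemma comm_eps z : lam z -> z * v eps = v eps * z.
Proof.
move=> [r [_ ->]]; rewrite mulr_suml mulr_sumr; apply: eq_bigr => i _.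
by rewrite -mulrA YXv iter_fixed // !mulrA -!rmorphM mulrC.
Qed.

Lemma eqeMl t z w : lam t -> eqe z w -> eqe (t * z) (t * w).
Proof.
move=> lt [a la Ea]; exists (t * a); first exact: lamM.
by rewrite -mulrBr Ea !mulrA comm_eps.
Qed.

Lemma eqeN z w : eqe z w -> eqe (- z) (- w).
Proof. by move=> /(eqeMl (lamN lam1)); rewrite !mulN1r. Qed.

(** Since (1 - Y) tau = eps, multiplication by Y fixes tau modulo eps. *)
Lemma YX_tau i : eqe (Y ^+ i * tau) tau.
Proof.
elim: i => [|i IH]; first by rewrite mul1r; apply: eqe_refl.
rewrite exprS -mulrA; apply: eqe_trans (eqeMl lamY IH) _.
exists (- 1); first exact/lamN/lam1.
by rewrite mulrN1 -mul_1Y_tau mulrBl mul1r opprB.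
Qed.

(** Modulo eps the left ideal generated by tau reduces to [v th * tau] with th in R, because Y fixes
    tau; phi is the action of g in the coordinate th. *)
Definition acts (g : D) (phi : K -> K) : Prop :=
  [/\ lam g, forall th, R th -> R (phi th)
    & forall th, R th -> eqe (g * (v th * tau)) (v (phi th) * tau)].

Lemma acts_mul g h phi psi : acts g phi -> acts h psi -> acts (g * h) (phi \o psi).
Proof.
move=> [lg Rg ag] [lh Rh ah]; split=> [|th Rth|th Rth]; first exact: lamM.
  exact/Rg/Rh.
by rewrite -mulrA; apply: eqe_trans (eqeMl lg (ah _ Rth)) _; apply/ag/Rh.
Qed.

Lemma acts_v r : R r -> acts (v r) ( *%R r).
Proof.
move=> Rr; split=> [|th Rth|th Rth]; [exact: lam_v|exact: RM|].
by rewrite mulrA -rmorphM; apply: eqe_refl.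
Qed.

Lemma acts_1Y : acts (1 - Y) (fun th => th - sigma th).
Proof.
split=> [|th Rth|th Rth]; [exact/lamB/lamY/lam1|exact/RB/Rsigma|].
rewrite mulrBl mul1r mulrA Yv -mulrA rmorphB mulrBl.
apply: eqeD; first exact: eqe_refl.
apply: eqeN; apply: eqeMl; first exact/lam_v/Rsigma.
by rewrite -[Y]expr1; apply: YX_tau.
Qed.

Lemma acts_tau : acts tau tr.
Proof.
split=> [|th Rth|th Rth]; [exact: lam_tau|exact: R_tr|].
rewrite rmorph_sum !mulr_suml; apply: eqe_sum => i.
rewrite mulrA YXv -mulrA; apply: eqeMl; last exact: YX_tau.
exact/lam_v/Riter.
Qed.

Lemma acts_ext g phi psi : phi =1 psi -> acts g phi -> acts g psi.
Proof. by move=> /funext <-. Qed.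

Hypothesis (Y1_unit : 1 - Y \is a GRing.unit).

Lemma v_unit k : k != 0 -> v k \is a GRing.unit.
Proof. by move=> k0; rewrite rmorph_unit // unitfE. Qed.

Definition good a := R a^-1 /\ a != 0.

Record linear_form (phi : K -> K) : Prop := LinearForm {
  lf_R : forall th, R th -> R (phi th);
  lf_fixed : forall th, sigma (phi th) = phi th;
  lf_lin : forall u th, sigma u = u -> phi (u * th) = u * phi th }.

(* Up to a power of eps, g acts on v(th) tau modulo eps as the rank one operator
   th |-> p phi(th), up to an invertible sigma-fixed scalar. *)
Record rank1 (g : D) (p : K) (phi : K -> K) (k : nat) (u : K) : Prop := Rank1 {
  rk_gt0 : (0 < k)%N;
  rk_u : [/\ R u, good u & sigma u = u];
  rk_comm : g * v eps = v eps * g;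
  rk_acts : acts (v eps ^+ k * g) (fun th => u * p * phi th) }.

Definition rk g p phi := exists k u, rank1 g p phi k u.

Lemma rk_ext g p phi q psi : p = q -> phi =1 psi -> rk g p phi -> rk g q psi.
Proof. by move=> -> /funext ->. Qed.

Lemma goodM a b : good a -> good b -> good (a * b).
Proof. by move=> [Ra a0] [Rb b0]; split; rewrite ?mulf_neq0 // invfM; apply: RM. Qed.

Lemma comm_epsX g k : g * v eps = v eps * g -> g * v eps ^+ k = v eps ^+ k * g.
Proof.
move=> cg; elim: k => [|k IH]; first by rewrite mulr1 mul1r.
by rewrite exprS mulrA cg -!mulrA IH.
Qed.

Lemma rk_actsr g h p phi eta : rk g p phi -> acts h eta -> rk (g * h) p (phi \o eta).
Proof.
move=> [k [u [k0 hu cg ag]]] ah; exists k, u; split=> //.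
  by rewrite -mulrA comm_eps ?mulrA ?cg //; case: ah.
by rewrite mulrA; apply: acts_ext (acts_mul ag ah).
Qed.

Lemma rk_vl g p phi r : R r -> rk g p phi -> rk (v r * g) (r * p) phi.
Proof.
move=> Rr [k [u [k0 hu cg ag]]]; exists k, u; split=> //.
  by rewrite -mulrA cg !mulrA -!rmorphM mulrC.
rewrite mulrA -rmorphXn -rmorphM mulrC rmorphM rmorphXn -mulrA.
by apply: acts_ext (acts_mul (acts_v Rr) ag) => th /=; rewrite !mulrA (mulrC r).
Qed.

(** Composing p phi with q psi gives phi(q) p psi. The scalar phi(q) is a unit of R fixed by sigma,
    so it is absorbed into u. *)
Lemma rk_mul g h p q phi psi : rk g p phi -> rk h q psi -> linear_form phi ->
  linear_form psi -> R q -> good (phi q) -> rk (g * h) p psi.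
Proof.
move=> [k [u [k0 [Ru gu fu] cg ag]]] [l [w [l0 [Rw gw fw] ch ah]]] lphi lpsi Rq gq.
exists (k + l)%N, (u * w * phi q); split.
- by rewrite addn_gt0 k0.
- split; first by apply: RM; [exact: RM | exact: lf_R].
    by apply: goodM => //; apply: goodM.
  by rewrite !rmorphM fu fw (lf_fixed lphi).
- by rewrite -mulrA ch !mulrA cg.
have -> : v eps ^+ (k + l) * (g * h) = v eps ^+ k * g * (v eps ^+ l * h).
  by rewrite exprD -!mulrA; congr (_ * _); rewrite !mulrA comm_epsX.
apply: acts_ext (acts_mul ag ah) => th /=.
rewrite (_ : w * q * psi th = (w * psi th) * q); last by rewrite mulrAC.
rewrite (lf_lin lphi) ?rmorphM ?fw ?(lf_fixed lpsi) //; ring.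
Qed.

(** As k > 0, eps^k kills [v th * tau] modulo eps, yet it should send it to [v m * tau] with m a
    unit of R. Comparing the coefficients of Y^0 puts m in eps R, so eps would be invertible in
    R. *)
Lemma rk1_absurd p phi th : rk 1 p phi -> linear_form phi -> R p -> good p -> R th ->
  good (phi th) -> False.
Proof.
move=> [k [u [k0 [Ru gu fu] _ [_ _ ag]]]] lphi Rp gp Rth gth.
have [t [r [Rr tE]]] := ag th Rth; set m := u * p * phi th => E.
have gm : good m by apply: goodM => //; apply: goodM.
have [s [Rs sE]] : lam (v eps ^+ k.-1 * (v th * tau)).
  by rewrite -rmorphXn mulrA -rmorphM; apply: lam_vl lam_tau; apply/RM/Rth/RX.
have : \sum_i v (m - eps * (s i - r i)) * Y ^+ i = 0.
  transitivity (v m * tau - v eps * (v eps ^+ k.-1 * (v th * tau) - t)).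
    rewrite sE tE /tau mulrBr !mulr_sumr -!sumrB; apply: eq_bigr => i _.
    by rewrite !(rmorphB, rmorphM) /= mulrBl mulrBr mulrBl !mulrA.
  rewrite mulrBr [v eps * (_ * _)]mulrA -exprS prednK // -E mulr1.
  by rewrite subKr subrr.
move=> /Y_independent /(_ (Ordinal n_gt0)) /eqP; rewrite subr_eq0 => /eqP mE.
apply: (@eps_nonunit ((s (Ordinal n_gt0) - r (Ordinal n_gt0)) * m^-1)).
  by case: gm => Rm _; apply: RM => //; apply: RB.
by rewrite mulrAC [_ * eps]mulrC -mE mulfV //; case: gm.
Qed.

Lemma R_del k : R k -> R (del k). Proof. by move=> Rk; apply/RB/Rsigma. Qed.

Lemma Psi_linear z b d : R z -> R b -> R d^-1 -> linear_form (Psi z b d).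
Proof.
move=> Rz Rb Rd; split=> [th Rth|th|u th su].
- by apply/R_tr/RM/R_del/RM/R_del/RM.
- exact: tr_fixed.
by rewrite /Psi (mulrCA d^-1) (delM _ su) (mulrCA b) (delM _ su) (mulrCA z) (trM _ su).
Qed.

Lemma linear_form_mulr phi r : R r -> linear_form phi ->
  linear_form (fun th => phi (r * th)).
Proof.
move=> Rr [h1 h2 h3]; split=> [th Rth|th|u th su]; [exact/h1/RM|exact: h2|].
by rewrite /= (mulrCA r) (h3 _ _ su).
Qed.

Lemma rk_vr g p phi r : R r -> rk g p phi -> rk (g * v r) p (fun th => phi (r * th)).
Proof. by move=> Rr rg; apply: rk_ext (rk_actsr rg (acts_v Rr)). Qed.

(** Each product splits into a twist of g^-1, which gives the image line, and a factor containing g,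
    which gives the form. The pairings in between are phi'(z^-1 p) and phi'(z p). *)
Lemma rk_commutator g p phi p' phi' z : R z -> R z^-1 -> z != 0 ->
  rk g p phi -> rk g^-1 p' phi' -> linear_form phi -> linear_form phi' -> R p ->
  good (phi' (z^-1 * p)) -> good (phi' (z * p)) ->
  rk (g^-1 * v z^-1 * g * v z) p' (fun th => phi (z * th)) /\
  rk (v z^-1 * g^-1 * v z * g) (z^-1 * p') phi.
Proof.
move=> Rz RVz z0 rg rVg lphi lphi' Rp g1 g2; split.
  apply: rk_vr => //; apply: rk_mul (rk_vr RVz rVg) rg _ _ _ _ => //.
  exact: linear_form_mulr.
rewrite -[_ * _ * v z]mulrA; apply: rk_mul (rk_vl RVz (rk_vr Rz rVg)) rg _ _ _ _ => //.
exact: linear_form_mulr.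
Qed.

Section CommutatorSequence.
Variables (z b : K).
Hypotheses (Rz : R z) (gz : good z) (Rb : R b) (gb : good b) (gtb : good (tr b^-1)).

Definition start (d : K) : D := v d * (1 - Y) * v b * (1 - Y) * v d^-1.
Fixpoint cseq (d : K) (j : nat) : D :=
  if j is i.+1 then (cseq d i)^-1 * v z^-1 * cseq d i * v z else start d.

Lemma cseq_unit d j : d != 0 -> cseq d j \is a GRing.unit.
Proof.
move=> d0; have [_ z0] := gz; have [_ b0] := gb; elim: j => [|j IH] /=.
  by rewrite /start !unitrMr ?v_unit ?invr_neq0 // Y1_unit.
by rewrite !unitrMr ?unitrV ?v_unit ?invr_neq0.
Qed.

Lemma cseqV d j : d != 0 -> (cseq d j.+1)^-1 = v z^-1 * (cseq d j)^-1 * v z * cseq d j.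
Proof.
move=> d0; have [_ z0] := gz; have cu := cseq_unit j d0.
have uz := v_unit z0; have uz' := v_unit (invr_neq0 z0).
rewrite /= !invrM ?unitrMr ?unitrV // invrK -!rmorphV ?unitfE ?invr_neq0 // invrK.
by rewrite !mulrA.
Qed.

Lemma acts_start d : R d -> R d^-1 -> acts (start d) (fun th => d * del (b * del (d^-1 * th))).
Proof.
move=> Rd RVd; rewrite /start -!mulrA.
apply: acts_ext (acts_mul (acts_v Rd) (acts_mul acts_1Y (acts_mul (acts_v Rb)
  (acts_mul acts_1Y (acts_v RVd))))).
by [].
Qed.

(** The inverse of 1 - Y is tau up to eps, and the two factors 1 - Y of [start d] account for
    eps^2. *)
Lemma start_inv d : R d -> good d ->
  v eps ^+ 2 * (start d)^-1 = v d * tau * v b^-1 * tau * v d^-1.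
Proof.
move=> Rd [RVd d0]; have [_ b0] := gb; apply: (mulrI (cseq_unit 0 d0)) => /=.
have vK k : k != 0 -> v k^-1 * v k = 1 by move=> k0; rewrite -rmorphM mulVf // rmorph1.
have vVK k : k != 0 -> v k * v k^-1 = 1 by move=> k0; rewrite -rmorphM mulfV // rmorph1.
have [lA _ _] := acts_start Rd RVd.
rewrite mulrA comm_epsX ?comm_eps // mulrK ?(cseq_unit 0) // /start.
have -> : v d * (1 - Y) * v b * (1 - Y) * v d^-1 * (v d * tau * v b^-1 * tau * v d^-1)
  = v d * (1 - Y) * v b * ((1 - Y) * (v d^-1 * v d * tau)) * v b^-1 * tau * v d^-1.
  by rewrite !mulrA.
rewrite vK // mul1r mul_1Y_tau -!mulrA (mulrA (v b)) comm_eps; last exact: lam_v.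
rewrite -mulrA (mulrA (v b)) vVK // mul1r (mulrA (1 - Y) (v eps)).
rewrite comm_eps; last exact/lamB/lamY/lam1.
rewrite -mulrA (mulrA (1 - Y) tau) mul_1Y_tau (mulrA (v d)) comm_eps; last exact: lam_v.
rewrite -mulrA (mulrA (v d) (v eps)) comm_eps; last exact: lam_v.
by rewrite -mulrA vVK // mulr1 expr2.
Qed.

(** Two traces in a row collapse: trace (b^-1 trace k) = trace b^-1 trace k. This is where rank one
    enters; the first commutator and its inverse each contain one factor [(start d)^-1] and inherit
    it. *)
Lemma rk_start_inv d : R d -> good d -> rk (start d)^-1 d (fun th => tr (d^-1 * th)).
Proof.
move=> Rd gd; have [RVd d0] := gd; have [RVb b0] := gb.
have [lA _ _] := acts_start Rd RVd.
exists 2%N, (tr b^-1); split=> //.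
- by split=> //; exact: R_tr.
- by apply/esym/commrV/esym/comm_eps.
rewrite start_inv // -!mulrA.
apply: acts_ext (acts_mul (acts_v Rd) (acts_mul acts_tau (acts_mul (acts_v RVb)
  (acts_mul acts_tau (acts_v RVd))))) => th /=.
by rewrite [b^-1 * _]mulrC (trM _ (tr_fixed _)); ring.
Qed.

(* From the second commutator on, c_j and its inverse act through the same form
   Psi z^-1, with the image line and the kernel both moved by powers of z. *)
Lemma rk_cseq d j : R d -> good d ->
  (forall w, w = z \/ w = z^-1 -> good (Psi w b d (z * d)) /\ good (Psi w b d (z^-1 * d))) ->
  rk (cseq d j.+1) (z ^- j * d) (fun th => Psi z^-1 b d (z ^+ j.+1 * th)) /\
  exists w, [/\ w = z \/ w = z^-1, (0 < j)%N -> w = z^-1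
    & rk (cseq d j.+1)^-1 (z ^- j.+1 * d) (fun th => Psi w b d (z ^+ j * th))].
Proof.
move=> Rd gd gPsi; have [RVd d0] := gd; have [RVz z0] := gz; have [RVb b0] := gb.
have rs := rk_start_inv Rd gd; have as_ := acts_start Rd RVd.
have lPsi w : w = z \/ w = z^-1 -> linear_form (Psi w b d).
  by move=> hw; apply: Psi_linear => //; case: hw => ->.
elim: j => [|j [IH [w [hw _ IHV]]]].
  have E w th : tr (d^-1 * (w * (d * del (b * del (d^-1 * th))))) = Psi w b d th.
    by rewrite (mulrCA w) mulKf.
  split.
    rewrite /= expr0 invr1 mul1r -[_ * start d * v z]mulrA.
    apply: (rk_ext _ _ (rk_actsr (rk_vr RVz rs) (acts_mul as_ (acts_v Rz)))) => // th.
    by rewrite /= E expr1.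
  exists z; split=> //; first by left.
  rewrite cseqV //= expr1 -[_ * start d]mulrA -[_ * (v z * start d)]mulrA.
  apply: rk_vl => //; apply: (rk_ext _ _ (rk_actsr rs (acts_mul (acts_v Rz) as_))) => // th.
  by rewrite /= E mul1r.
have zX0 k : z ^+ k != 0 by rewrite expf_neq0.
have cancel_z k q : z ^+ k * (q * (z ^- k * d)) = q * d.
  by rewrite mulrCA mulVKf.
have [gw gw'] := gPsi w hw.
have R_zV k : R (z ^- k) by rewrite -exprVn; apply: RX.
have [|||||rc rcV] := @rk_commutator _ _ _ _ _ z Rz RVz z0 IH IHV.
- by apply: linear_form_mulr (lPsi _ _); [exact: RX | right].
- by apply: linear_form_mulr (lPsi _ _) => //; exact: RX.
- exact: RM.
- by rewrite cancel_z.
- by rewrite cancel_z.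
split.
  apply: rk_ext rc => // th /=.
  by rewrite mulrA -exprSr.
exists z^-1; split=> //; first by right.
rewrite cseqV //; apply: rk_ext rcV => //.
by rewrite mulrA -invfM -exprS.
Qed.

Section Words.
Variables (d : bool -> K) (J : nat).
Hypotheses (Rd : forall i, R (d i)) (gd : forall i, good (d i)).
Hypothesis good_start : forall i, good (Psi z b (d i) (z * d i)) /\ good (Psi z b (d i) (z^-1 * d i)).
Hypothesis good_z : forall i k, good (Psi z^-1 b (d i) (z * d k)).
Hypothesis good_zV : forall i k, good (Psi z^-1 b (d i) (z^-1 * d k)).
Hypothesis good_neq : forall i k, i != k -> good (Psi z^-1 b (d i) (d k)).

(** From index 2 on, an element of the commutator sequence and its inverse both act through
    [Psi z^-1]; J leaves room for the depth of the subnormal series. *)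
Definition letter (a : bool * bool) : D :=
  if a.2 then cseq (d a.1) J.+2 else (cseq (d a.1) J.+2)^-1.
Definition letter_vec (a : bool * bool) : K :=
  (if a.2 then z ^- J.+1 else z ^- J.+2) * d a.1.
Definition letter_form (a : bool * bool) (th : K) : K :=
  Psi z^-1 b (d a.1) ((if a.2 then z ^+ J.+2 else z ^+ J.+1) * th).

Lemma rk_letter a : rk (letter a) (letter_vec a) (letter_form a).
Proof.
case: a => i e0; have [|rc [w [_ w_eq rcV]]] := @rk_cseq (d i) J.+1 (Rd i) (gd i).
  by move=> w [->|->]; [exact: good_start | split; [exact: good_z | exact: good_zV]].
rewrite (w_eq isT) in rcV; case: e0; [exact: rc | exact: rcV].
Qed.

Lemma R_letter_vec a : R (letter_vec a).
Proof.
have [RVz _] := gz; apply: RM => //.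
by case: ifP => _; rewrite -exprVn; apply: RX.
Qed.

Lemma good_letter_vec a : good (letter_vec a).
Proof.
have [RVz z0] := gz; apply: goodM => //.
by case: ifP => _; split; rewrite ?invrK ?invr_eq0 ?expf_neq0 //; apply: RX.
Qed.

Lemma letter_form_linear a : linear_form (letter_form a).
Proof.
have [RVz _] := gz; apply: linear_form_mulr; first by case: ifP => _; apply: RX.
by apply: Psi_linear => //; case: (gd a.1).
Qed.

Definition nocancel (a c : bool * bool) := ~~ ((a.1 == c.1) && (a.2 != c.2)).

(** The powers of z telescope. Equal signs leave [z * d k] or [z^-1 * d k]; opposite signs leave
    [d k], and there reducedness forces distinct indices, as [good_neq] requires. *)
Lemma good_adjacent a c : nocancel a c -> good (letter_form a (letter_vec c)).
Proof.
have [_ z0] := gz; have zX0 k : z ^+ k != 0 by rewrite expf_neq0.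
case: a c => i e1 [k e2]; rewrite /nocancel /letter_form /letter_vec /= => h.
have E m : z ^+ m.+1 * (z ^- m * d k) = z * d k.
  by rewrite exprS -mulrA mulVKf.
have E' m : z ^+ m * (z ^- m.+1 * d k) = z^-1 * d k.
  by rewrite exprS invfM -mulrA mulrCA mulVKf.
have E'' m : z ^+ m * (z ^- m * d k) = d k by rewrite mulVKf.
case: e1 e2 h => [] [] h; rewrite ?E ?E' ?E'' //; apply: good_neq.
  by move: h; rewrite andbT.
by move: h; rewrite andbT.
Qed.

Lemma rk_word w a : path nocancel a w ->
  rk (\prod_(c <- a :: w) letter c) (letter_vec a) (letter_form (last a w)).
Proof.
elim: w a => [|c w IH] a /=; first by rewrite big_seq1 => _; apply: rk_letter.
case/andP=> ac /IH rw; rewrite big_cons.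
apply: rk_mul (rk_letter a) rw _ _ (R_letter_vec c) (good_adjacent ac);
  exact: letter_form_linear.
Qed.

Lemma word_neq1 w : w != [::] -> sorted nocancel w -> \prod_(c <- w) letter c <> 1.
Proof.
case: w => // a w _ /= /rk_word rw E1; rewrite E1 in rw.
(* The test vector is that of the last letter: a letter may follow itself, so [good_adjacent] makes
   the value of its form good. *)
apply: (@rk1_absurd _ _ (letter_vec (last a w)) rw) => //.
- exact: letter_form_linear.
- exact: R_letter_vec.
- exact: good_letter_vec.
- exact: R_letter_vec.
- by apply: good_adjacent; rewrite /nocancel eqxx eqxx.
Qed.
End Words.
End CommutatorSequence.
End RankOne.
End Independence.
End TwistedPolynomials.

Lemma alg_rmorph (P : idomainType) (K : fieldType) (iota : {rmorphism P -> K})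
    (sigma : {rmorphism K -> K}) z :
  (forall a, sigma (iota a) = iota a) -> alg_over iota z -> alg_over iota (sigma z).
Proof.
move=> fix_s [p p0 pz]; exists p => //.
have -> : map_poly iota p = map_poly sigma (map_poly iota p).
  by rewrite -map_poly_comp; apply: eq_map_poly => a /=; rewrite fix_s.
by apply: rmorph_root.
Qed.

(** * The choice of R and omega, and two elements without relations *)

Section CrossedPair.
Variables (D : unitRingType) (hD : is_division_ring D).
Variables (K : fieldType) (v : {rmorphism K -> D}) (sigma : {rmorphism K -> K}).
Variables (y : D) (n : nat) (x c : K) (P : idomainType) (iota : {rmorphism P -> K}).
Hypotheses (yv : forall k, y * v k = v (sigma k) * y) (y_unit : y \is a GRing.unit).
Hypotheses (n_gt1 : (1 < n)%N) (yn : y ^+ n = v c).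
Hypothesis x_orbit : forall i, (0 < i < n)%N -> iter i sigma x <> x.
Hypotheses (x0 : x != 0) (base : good_base sigma iota).
Hypotheses (alg_x : alg_over iota x) (alg_c : alg_over iota c).

Let n_gt0 : (0 < n)%N := ltnW n_gt1.

Lemma alg_Psi z b d th : alg_over iota z -> alg_over iota b -> d != 0 -> alg_over iota d ->
  alg_over iota th -> alg_over iota (Psi sigma n z b d th).
Proof.
have [i_inj _ _ fix_i] := base => az ab d0 ad ath.
have alg_sig k : alg_over iota k -> alg_over iota (sigma k) by apply: alg_rmorph.
have alg_del k : alg_over iota k -> alg_over iota (del sigma k).
  by move=> ak; apply: alg_add => //; apply: alg_opp => //; apply: alg_sig.
apply: alg_sum => // i _; elim: (nat_of_ord i) => [|j] /=; last exact: alg_sig.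
have adV : alg_over iota d^-1 by apply: alg_inv.
apply: (alg_mul i_inj az); apply: (alg_del); apply: (alg_mul i_inj ab); apply: (alg_del).
exact: alg_mul.
Qed.

Lemma crossed_free_pair : exists A : bool -> D,
  (forall i, A i \is a GRing.unit) /\
  forall J (w : seq (bool * bool)), w != [::] -> sorted nocancel w ->
    let g i := iter J.+2 (fun u => u^-1 * v x^-1 * u * v x) (A i) in
    \prod_(a <- w) (if a.2 then g a.1 else (g a.1)^-1) <> 1.
Proof.
have [i_inj hP _ fix_i] := base.
have sigma_n := iter_n_id yv yn y_unit.
have [b [d [b0 alg_b tb hd [h1 h2 h3 h4 h5]]]] :=
  generic_data n_gt0 sigma_n x_orbit x0 n_gt1 base alg_x.
have d0 i : d i != 0 by case: (hd i).
have alg_d i : alg_over iota (d i) by case: (hd i).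
have c0 : c != 0.
  apply: contraTneq (unitrX n y_unit) => c0; by rewrite yn c0 rmorph0 unitr0.
pose pm (s : bool) := if s then x else x^-1.
have alg_pm s : alg_over iota (pm s) by case: s => //=; apply: alg_inv.
have alg1 : alg_over iota 1 by rewrite -(rmorph1 iota); apply: alg_id.
pose pm1 (s : option bool) := if s is Some t then pm t else 1.
have alg_pm1 s : alg_over iota (pm1 s) by case: s.
(* All values of Psi that may have to be units of R, indexed by a finite type so that they can be
   listed; [None] encodes the absence of a factor x or x^-1. *)
pose F (t : bool * bool * bool * option bool) :=
  let: (s, i, k, s') := t in Psi sigma n (pm s) b (d i) (pm1 s' * d k).
have alg_F t : alg_over iota (F t).
  by case: t => [[[s i] k] s']; apply: alg_Psi => //; apply: alg_mul.
have alg_s k : alg_over iota k -> alg_over iota (sigma k) by apply: alg_rmorph.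
pose L := [:: x; c; b; d true; d false; trace sigma n b^-1] ++
  map F (enum (xpredT : pred (bool * bool * bool * option bool))).
have alg_L z : z \in L -> alg_over iota z.
  rewrite mem_cat => /orP[|/mapP[t _ ->] //].
  rewrite !inE => /or4P[/eqP->//|/eqP->//|/eqP->//|/or3P[/eqP->//|/eqP->//|/eqP->]].
  apply: alg_sum => // i _; elim: (nat_of_ord i) => [|j] /=; last exact: alg_s.
  exact: alg_inv.
have alg_LV z : z \in L ++ map GRing.inv L -> alg_over iota z.
  rewrite mem_cat => /orP[/alg_L //|/mapP[z' z'L ->]].
  by apply: alg_inv => //; apply: alg_L.
have [delta delta0 hdelta] := common_integral i_inj alg_LV.
pose R := int_frac iota delta.
have RL z : z \in L -> R z.
  by move=> zL; exists 1%N; rewrite expr1; apply: hdelta; rewrite mem_cat zL.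
have RLV z : z \in L -> R z^-1.
  by move=> zL; exists 1%N; rewrite expr1; apply: hdelta; rewrite mem_cat map_f ?orbT.
have R1 : R 1 by apply: int_frac1.
have RM z w : R z -> R w -> R (z * w) by apply: int_frac_mul.
have RB z w : R z -> R w -> R (z - w).
  by move=> Rz Rw; apply: int_frac_add => //; apply: int_frac_opp.
have Rs z : R z -> R (sigma z) by apply: int_frac_rmorph.
have [xL cL bL tL] : [/\ x \in L, c \in L, b \in L & trace sigma n b^-1 \in L].
  by rewrite !mem_cat !inE !eqxx !orbT.
have dL i : d i \in L by case: i; rewrite mem_cat !inE eqxx !orbT.
have FL t : F t \in L by rewrite mem_cat map_f ?orbT // mem_enum.
have gL z : z \in L -> z != 0 -> good R z by move=> zL z0; split=> //; apply: RLV.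
(* As 1 - omega^n c = - c (omega^n - c^-1), the element omega is chosen for kappa = c^-1. *)
have [om omP] := nonunit_value i_inj hP delta0 (alg_inv i_inj alg_c) (invr_neq0 c0) n_gt0.
have sc : sigma c = c.
  apply: (fmorph_inj v); apply: (mulIr y_unit).
  by rewrite -yv -yn -exprS exprSr.
pose e := iota om ^+ n * c.
have Rom : R (iota om) by apply: int_frac_id.
have Re : R e by apply: RM; [rewrite /R -rmorphXn; apply: int_frac_id | exact: RL].
have eps_fixed : sigma (1 - e) = 1 - e.
  by rewrite rmorphB rmorph1 rmorphM rmorphXn sc fix_i.
have eps_nonunit u : R u -> u * (1 - e) <> 1.
  move=> Ru E; apply: (omP (- u * c)).
    by apply: RM; [exact: int_frac_opp | exact: RL].
  by rewrite -[RHS]E /e; field.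
have om0 : iota om != 0.
  apply/eqP => om0; apply: (eps_nonunit 1 R1).
  by rewrite /e om0 expr0n gtn_eqF // mul0r subr0 mul1r.
pose Y := v (iota om) * y.
have Yv k : Y * v k = v (sigma k) * Y.
  by rewrite /Y -mulrA yv !mulrA -!rmorphM mulrC.
have Y_unit : Y \is a GRing.unit.
  by rewrite unitrMr // rmorph_unit // unitfE.
have Yn : Y ^+ n = v e.
  rewrite /Y exprMn_comm; first by rewrite yn -rmorphXn -rmorphM.
  by rewrite /GRing.comm yv fix_i.
have Y1_unit : 1 - Y \is a GRing.unit.
  apply: hD; rewrite subr_eq0 eq_sym; apply/eqP => Y1.
  apply: (@x_orbit 1 n_gt1); apply: (fmorph_inj v).
  by have := Yv x; rewrite Y1 mul1r mulr1.
have eE : e = 1 - (1 - e) by rewrite subKr.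
exists (start v Y b \o d); split.
  have vu k : k != 0 -> v k \is a GRing.unit by move=> k0; rewrite rmorph_unit // unitfE.
  by move=> i; rewrite /= /start !unitrMr ?vu ?invr_neq0.
move=> J w w0 sw g.
have := @word_neq1 D K v sigma Y n e Yv n_gt0 Yn R R1 RB RM Rs Re x x_orbit Y_unit
  (1 - e) eE (RB _ _ R1 Re) eps_fixed eps_nonunit Y1_unit x b (RL _ xL) (gL _ xL x0)
  (RL _ bL) (gL _ bL b0) (gL _ tL tb) d J (fun i => RL _ (dL i)) (fun i => gL _ (dL i) (d0 i)).
have gF t : F t != 0 -> good R (F t) by apply/gL/FL.
move=> W; have {}W := W _ _ _ _ w w0 sw.
have gE i : g i = cseq v Y x b (d i) J.+2.
  rewrite /g; elim: J.+2 => //= j ->; by rewrite fmorphV.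
rewrite (eq_bigr (letter v Y x b d J)).
  apply: W.
  - move=> i; split; first exact: (gF (true, i, i, Some true) (h1 i)).
    exact: (gF (true, i, i, Some false) (h2 i)).
  - by move=> i k; exact: (gF (false, i, k, Some true) (h3 i k)).
  - by move=> i k; exact: (gF (false, i, k, Some false) (h4 i k)).
  - move=> i k ik; have := gF (false, i, k, None); rewrite /F /pm1 mul1r; apply; exact: h5.
by move=> [i e'] _; rewrite /letter /= gE.
Qed.
End CrossedPair.

(** * Division subrings and Wedderburn's theorem *)

Definition divring_pred (D : unitRingType) (S : {pred D}) (_ : divring_closed S) : {pred D} := S.

Record divring_sub (D : unitRingType) (S : {pred D}) (clS : divring_closed S) := DivringSub {
  divring_val : D;
  divring_valP : divring_val \in divring_pred clS }.

Section DivringSub.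
Variables (D : unitRingType) (S : {pred D}) (clS : divring_closed S).

HB.instance Definition _ := GRing.isDivringClosed.Build D (divring_pred clS) clS.
HB.instance Definition _ := [isSub for @divring_val D S clS].
HB.instance Definition _ := [Choice of divring_sub clS by <:].
HB.instance Definition _ := [SubChoice_isSubUnitRing of divring_sub clS by <:].
Definition divring_sub_unitRing : unitRingType := divring_sub clS.
Definition divring_incl : {rmorphism divring_sub clS -> D} := val.
End DivringSub.

Lemma commutative_divring_field (D : unitRingType) (S : {pred D}) (clS : divring_closed S) :
  is_division_ring D -> {in S &, commutative (@GRing.mul D)} ->
  exists (K : fieldType) (v : {rmorphism K -> D}), forall z, z \in S <-> exists k, v k = z.
Proof.
move=> hD comS; pose R := divring_sub_unitRing clS.
have mulC : @commutative R R *%R.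
  by move=> a b; apply/val_inj/comS; [exact: (valP a) | exact: (valP b)].
have fieldR : GRing.field_axiom R.
  move=> a a0; apply/unitrP.
  have ua : val a \is a GRing.unit.
    by apply: hD; apply: contra a0 => /eqP va; apply/eqP/val_inj; rewrite va.
  have [S1 _ Sdiv] := clS.
  have Sa : (val a)^-1 \in divring_pred clS by rewrite -[_^-1]mul1r; apply: Sdiv (valP a).
  by exists (DivringSub Sa); split; apply: val_inj; rewrite /= ?mulVr ?mulrV.
pose cC := GRing.PzRing_hasCommutativeMul.Build R mulC.
pose cR : comUnitRingType := HB.pack R cC.
have domR : GRing.integral_domain_axiom cR.
  move=> a b /eqP ab0; apply/norP => -[a0 b0].
  move/eqP: ab0 => ab0; move: b0; rewrite -(mulKr (fieldR a a0 : (a : cR) \is a GRing.unit) b).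
  by rewrite (_ : (a : cR) * b = 0) ?mulr0 ?eqxx //; apply/eqP.
pose iC := GRing.ComUnitRing_isIntegral.Build cR domR.
pose iR : idomainType := HB.pack cR iC.
pose fC := GRing.UnitRing_isField.Build iR fieldR.
pose K : fieldType := HB.pack iR fC.
exists K, (divring_incl clS) => z; split=> [Sz|[k <-]]; last exact: (valP (k : R)).
by exists (DivringSub (Sz : z \in divring_pred clS)).
Qed.

(** Left multiplication by a nonzero element is injective on the finite list, hence reaches 1, which
    gives inverses; Wedderburn's theorem [finDomain_mulrC] then applies to the resulting finite
    ring. *)
Lemma finite_subring_comm (D : unitRingType) (s : seq D) : is_division_ring D ->
  1 \in s -> {in s &, forall a b, a - b \in s} -> {in s &, forall a b, a * b \in s} ->
  {in s &, commutative (@GRing.mul D)}.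
Proof.
move=> hD s1 sB sM.
have sV a : a \in s -> a^-1 \in s.
  move=> sa; have [->|a0] := eqVneq a 0; first by rewrite invr0 -(subrr 1); apply: sB.
  have ua := hD a a0.
  have [z sz /esym az] : exists2 z, z \in undup s & 1 = a * z.
    have U : uniq (map ( *%R a) (undup s)) by rewrite map_inj_uniq ?undup_uniq //; apply: mulrI.
    have Sub : {subset map ( *%R a) (undup s) <= undup s}.
      by move=> _ /mapP[w sw ->]; rewrite mem_undup in sw *; rewrite mem_undup; apply: sM.
    have [_ eqi] := uniq_min_size U Sub (eq_leq (esym (size_map _ _))).
    by apply/mapP; rewrite eqi mem_undup.
  by rewrite -[a^-1]mulr1 -az mulKr // -mem_undup.
have clS : divring_closed (mem s).
  by split=> // a b sa sb; apply: sM => //; exact: sV.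
pose R := divring_sub_unitRing clS.
pose f (a : R) : seq_sub s := SeqSub (valP a).
pose g (a : seq_sub s) : R := DivringSub (valP a : val a \in divring_pred clS).
have fK : cancel f g by move=> a; apply: val_inj.
pose cR : countType := HB.pack R (Countable.copy R (can_type fK)).
pose fR : finType := HB.pack cR (CanIsFinite (fK : cancel (f : cR -> seq_sub s) g)).
pose FR : finUnitRingType := HB.pack_for finUnitRingType R (Countable.copy R cR) (Finite.copy R fR).
have domR : GRing.integral_domain_axiom FR.
  move=> a b ab0; apply/norP => -[a0 b0].
  have va : val (a : R) != 0 by apply: contra a0 => /eqP va; apply/eqP/val_inj.
  have vb : val (b : R) != 0 by apply: contra b0 => /eqP vb; apply/eqP/val_inj.
  have /eqP := congr1 (fun z : R => val z) ab0; apply/negP.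
  by rewrite -[X in _ != X]/(0 : D) -(mulr0 (val (a : R))) (inj_eq (mulrI (hD _ va))).
move=> a b sa sb.
have := finDomain_mulrC domR (DivringSub (sa : a \in divring_pred clS))
  (DivringSub (sb : b \in divring_pred clS)).
by move=> /(congr1 (fun z : R => val z)).
Qed.

(** * Conjugation by y, and the cyclic algebra generated by x and y *)

Lemma conjugation_endomorphism (D : unitRingType) (K : fieldType) (v : {rmorphism K -> D})
    (y : D) :
  y \is a GRing.unit -> (forall k, exists k', v k' = y * v k * y^-1) ->
  exists sigma : {rmorphism K -> K}, forall k, y * v k = v (sigma k) * y.
Proof.
move=> uy /choice[f fE].
have fy k : y * v k = v (f k) * y by rewrite fE mulrVK.
have f_zmod : zmod_morphism f.
  move=> a b; apply: (fmorph_inj v); apply: (mulIr uy).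
  by rewrite -fy !rmorphB mulrBr mulrBl !fy.
have f_mon : monoid_morphism f.
  split=> [|a b]; apply: (fmorph_inj v); apply: (mulIr uy).
    by rewrite -fy rmorph1 mulr1 mul1r.
  by rewrite -fy !rmorphM mulrA fy -!mulrA fy.
pose zf := GRing.isZmodMorphism.Build K K f f_zmod.
pose mf := GRing.isMonoidMorphism.Build K K f f_mon.
pose sigma : {rmorphism K -> K} := HB.pack f zf mf.
by exists sigma.
Qed.

Lemma central_poly_descent (D : unitRingType) (K : fieldType) (v : {rmorphism K -> D})
    (p : {poly D}) :
  (forall i, exists k, v k = p`_i) -> exists q : {poly K}, map_poly v q = p.
Proof.
move=> /choice[f fE]; exists (\poly_(i < size p) f i); apply/polyP => i.
rewrite coef_map coef_poly; case: ltnP => hi; first exact: fE.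
by rewrite [p`_i]nth_default //= raddf0.
Qed.

Lemma conj_exp (D : unitRingType) (u a : D) i :
  u \is a GRing.unit -> (u * a * u^-1) ^+ i = u * a ^+ i * u^-1.
Proof.
move=> uu; elim: i => [|i IH]; first by rewrite mulr1 divrr.
by rewrite !exprS IH !mulrA mulrVK.
Qed.

Lemma comm_conj (D : unitRingType) (u a b : D) : u \is a GRing.unit ->
  GRing.comm a b -> GRing.comm (u * a * u^-1) (u * b * u^-1).
Proof.
by move=> uu c; rewrite /GRing.comm !mulrA !mulrVK // -(mulrA u a) c !mulrA.
Qed.

Lemma root_conj (D : unitRingType) (p : {poly D}) (u a : D) : u \is a GRing.unit ->
  (forall i, center D p`_i) -> root p a -> root p (u * a * u^-1).
Proof.
move=> uu cp /rootP pa; apply/rootP.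
rewrite horner_coef (eq_bigr (fun i : 'I_(size p) => u * (p`_i * a ^+ i) * u^-1)).
  by rewrite -mulr_suml -mulr_sumr -horner_coef pa mulr0 mul0r.
by move=> i _; rewrite conj_exp // !mulrA (cp i u).
Qed.

(* A polynomial has finitely many roots among pairwise commuting elements. *)
Lemma exp_centralizes (D : unitRingType) (x y : D) (p : {poly D}) :
  is_division_ring D -> y \is a GRing.unit -> p != 0 ->
  (forall i, center D p`_i) -> root p x ->
  (forall i, GRing.comm x (y ^+ i * x * y ^- i)) ->
  exists2 m, (0 < m)%N & GRing.comm (y ^+ m) x.
Proof.
move=> hD uy p0 cp px xcomm; apply: contrapT => H.
pose f i := y ^+ i * x * y ^- i.
have uyX i : y ^+ i \is a GRing.unit by rewrite unitrX.
have fD i m : f (i + m)%N = y ^+ i * f m * y ^- i.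
  by rewrite /f exprD invrM // !mulrA.
have uyV i : y ^- i \is a GRing.unit by rewrite unitrV.
have f_comm i m : GRing.comm (f i) (f m).
  wlog le_im : i m / (i <= m)%N.
    by move=> W; case: (leqP i m) => [|/ltnW] h; [exact: W | apply/commr_sym/W].
  have := xcomm (m - i)%N; rewrite -/(f (m - i)%N) -(subnKC le_im) fD addKn => c.
  by apply: comm_conj.
have f_inj : injective f.
  move=> i m; wlog le_im : i m / (i <= m)%N.
    by move=> W; case: (leqP i m) => [|/ltnW] h E; [exact: W | apply/esym/W].
  move=> E; apply/eqP; rewrite eqn_leq le_im leqNgt /=; apply/negP => lt_im; apply: H.
  exists (m - i)%N; first by rewrite subn_gt0.
  move: E; rewrite -[in f m](subnKC le_im) fD => /(mulIr (uyV i))/(mulrI (uyX i)) E.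
  by rewrite /GRing.comm [in RHS]E /f mulrVK.
have : (size (map f (iota 0 (size p))) < size p)%N.
  apply: max_ring_poly_roots => //.
    by apply/allP => _ /mapP[i _ ->]; apply: root_conj.
  elim: (iota 0 (size p)) (iota_uniq 0 (size p)) => //= i s IH /andP[i_s /IH ->].
  rewrite andbT; apply/allP => _ /mapP[m ms ->]; rewrite /diff_roots f_comm eqxx /=.
  apply: hD; rewrite subr_eq0 (inj_eq f_inj); apply: contraNneq i_s => <- //.
by rewrite size_map size_iota ltnn.
Qed.

Lemma seq_of_roots (K : fieldType) (q : {poly K}) : q != 0 ->
  exists s : seq K, forall z, root q z <-> z \in s.
Proof.
elim: {q}(size q) {-2}q (leqnn (size q)) => [|m IH] q sq q0.
  by move: sq; rewrite leqn0 size_poly_eq0 (negPf q0).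
have [[z qz]|nr] := pselect (exists z, root q z); last first.
  by exists [::] => z; split=> // qz; case: nr; exists z.
have /factor_theorem[q' qE] := qz.
have q'0 : q' != 0 by apply: contraNneq q0 => q'0; rewrite qE q'0 mul0r.
have sq' : (size q' <= m)%N.
  by move: sq; rewrite qE size_Mmonic ?monicXsubC // size_XsubC addn2.
have [s sP] := IH q' sq' q'0; exists (z :: s) => w.
rewrite qE rootM root_XsubC in_cons orbC; split=> [/predU1P[->|/sP->]|/predU1P[->|/sP->]].
- by rewrite eqxx.
- by rewrite orbT.
- by rewrite eqxx.
- by rewrite orbT.
Qed.

(* All of the twisted polynomials over the finite field fixed by a power of
   Frobenius form a finite subring of D, commutative by Wedderburn. *)
Lemma frobenius_fixed_commute (D : unitRingType) (K : fieldType) (v : {rmorphism K -> D})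
    (sigma : {rmorphism K -> K}) (y : D) (n p : nat) (x c : K) :
  is_division_ring D -> (forall k, y * v k = v (sigma k) * y) -> (0 < n)%N ->
  y ^+ n = v c -> p \in [pchar K] ->
  (exists2 f, (0 < f)%N & x ^+ (p ^ f) = x) -> (exists2 f, (0 < f)%N & c ^+ (p ^ f) = c) ->
  y * v x = v x * y.
Proof.
move=> hD yv n_gt0 yn charKp [f1 f1_gt0 xf] [f2 f2_gt0 cf].
have pr_p := pcharf_prime charKp.
have frob_iter f z m : z ^+ (p ^ f) = z -> z ^+ (p ^ (f * m)) = z.
  by move=> zf; elim: m => [|m IH]; rewrite ?muln0 ?expr1 // mulnS expnD exprM zf.
pose f := (f1 * f2)%N; have f_gt0 : (0 < f)%N by rewrite muln_gt0 f1_gt0.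
pose R z := z ^+ (p ^ f) = z :> K.
have RB a b : R a -> R b -> R (a - b).
  have E m (u w : K) : (u - w) ^+ (p ^ m) = u ^+ (p ^ m) - w ^+ (p ^ m).
    elim: m => [|m IH]; first by rewrite !expr1.
    by rewrite expnSr !exprM IH -!(pFrobenius_autE charKp) rmorphB.
  by rewrite /R E => -> ->.
have R1 : R 1 by rewrite /R expr1n.
have RM a b : R a -> R b -> R (a * b) by rewrite /R exprMn => -> ->.
have Rs a : R a -> R (sigma a) by rewrite /R -rmorphXn => ->.
have Rx : R x by apply: frob_iter.
have Rc : R c by rewrite /R /f mulnC; apply: frob_iter.
have pf_gt1 : (1 < p ^ f)%N by rewrite -(expn0 p) ltn_exp2l // prime_gt1.
have [s sP] : exists s : seq K, forall z, R z <-> z \in s.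
  have q0 : 'X^(p ^ f) - 'X != 0 :> {poly K}.
    rewrite -size_poly_gt0 size_polyDl ?size_polyXn // size_polyN size_polyX ltnS.
    exact: pf_gt1.
  have [s sP] := seq_of_roots q0; exists s => z; rewrite -sP rootE !hornerE subr_eq0.
  by split=> /eqP.
pose L := map (fun r : {ffun 'I_n -> seq_sub s} => \sum_i v (val (r i)) * y ^+ i)
  (enum {: {ffun 'I_n -> seq_sub s}}).
have LP z : lam v y n R z <-> z \in L.
  split=> [[r [Rr ->]]|/mapP[r _ ->]]; last first.
    by exists (fun i => val (r i)); split=> // i; apply/sP/valP.
  have rs i : r i \in s by apply/sP.
  apply/mapP; exists [ffun i => SeqSub (rs i)]; first by rewrite mem_enum.
  by apply: eq_bigr => i _; rewrite ffunE.
have commL : {in L &, commutative (@GRing.mul D)}.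
  apply: finite_subring_comm => //.
  - exact/LP/(lam1 v y n_gt0 R1 RB).
  - by move=> a b /LP la /LP lb; apply/LP/(lamB R1 RB RM la lb).
  - by move=> a b /LP la /LP lb; apply/LP/(lamM yv n_gt0 yn R1 RB RM Rs Rc la lb).
apply: commL; first exact/LP/(lamY n_gt0 yn R1 RB RM Rc).
exact/LP/(lam_v v y n_gt0 R1 RB Rx).
Qed.

(** All powers of y are taken algebraic because the relevant one, y^n, is only determined inside the
    proof. *)
Lemma free_pair (D : unitRingType) (x y : D) :
  is_division_ring D -> x \is a GRing.unit -> y \is a GRing.unit -> ~ GRing.comm x y ->
  (forall i, GRing.comm x (y ^+ i * x * y ^- i)) ->
  algebraic_over (center D) [set x]%classic ->
  (forall k, algebraic_over (center D) [set y ^+ k]%classic) ->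
  exists A : bool -> D,
  (forall i, A i \is a GRing.unit) /\
  forall J (w : seq (bool * bool)), w != [::] -> sorted nocancel w ->
    let g i := iter J.+2 (fun u => u^-1 * x^-1 * u * x) (A i) in
    \prod_(a <- w) (if a.2 then g a.1 else (g a.1)^-1) <> 1.
Proof.
move=> hD ux uy xy xconj alg_x alg_y.
have [px [px0 cpx rx]] := alg_x x erefl.
have uyX i : y ^+ i \is a GRing.unit by rewrite unitrX.
have ex_n : exists m, (0 < m)%N && (y ^+ m * x == x * y ^+ m).
  have [m m0 cm] := exp_centralizes hD uy px0 cpx rx xconj.
  by exists m; rewrite m0; apply/eqP.
(* Minimality of n is what makes the conjugates of x by y^i, 0 < i < n, different from x. *)
case: (ex_minnP ex_n) => n /andP[n_gt0 /eqP yn_x] n_min.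
have n_gt1 : (1 < n)%N.
  rewrite ltn_neqAle n_gt0 andbT; apply/eqP => n1; apply: xy.
  by move: yn_x; rewrite -n1 expr1.
pose f i := y ^+ i * x * y ^- i.
have fS i : f i.+1 = y * f i * y^-1 by rewrite /f exprS invrM // !mulrA.
have f0 : f 0%N = x by rewrite /f invr1 mulr1 mul1r.
have [py [py0 cpy ry]] := alg_y n (y ^+ n) erefl.
pose T z := (exists i, z = f i) \/ z = y ^+ n.
have T_comm s t : T s -> T t -> GRing.comm s t.
  have yn_f i : GRing.comm (y ^+ n) (f i).
    have -> : y ^+ n = y ^+ i * y ^+ n * y ^- i by rewrite -exprD addnC exprD mulrK.
    by apply: comm_conj.
  have ff i m : GRing.comm (f i) (f m).
    wlog le_im : i m / (i <= m)%N.
      by move=> W; case: (leqP i m) => [|/ltnW] h; [exact: W | apply/commr_sym/W].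
    have -> : f m = y ^+ i * f (m - i)%N * y ^- i.
      by rewrite /f -{1 2}(subnKC le_im) exprD invrM // !mulrA.
    by apply: comm_conj => //; apply: xconj.
  by move=> [[i ->]|->] [[k ->]|->] //; apply/commr_sym.
have T_conj t : T t -> T (y * t * y^-1).
  move=> [[i ->]|->]; first by left; exists i.+1; rewrite fS.
  by right; rewrite -exprS exprSr mulrK.
pose CT w := forall s, T s -> GRing.comm w s.
(* S is the bicommutant of T: commutative because T is, stable under conjugation by y because T is,
   and containing the center, so that the equations of x and y^n descend to K. *)
pose S : {pred D} := fun z => `[< forall w, CT w -> GRing.comm z w >].
have SP z : reflect (forall w, CT w -> GRing.comm z w) (z \in S) by apply: asboolP.
have TS t : T t -> t \in S by move=> Tt; apply/SP => w /(_ t Tt)/commr_sym.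
have clS : divring_closed S.
  split=> [|a b /SP Sa /SP Sb|a b /SP Sa /SP Sb]; apply/SP => w cw; apply/commr_sym.
  - exact: commr1.
  - by apply: commrB; apply/commr_sym; [exact: Sa | exact: Sb].
  - by apply: commrM; [exact/commr_sym/Sa | exact/commrV/commr_sym/Sb].
have comS : {in S &, commutative (@GRing.mul D)}.
  by move=> a b /SP Sa /SP Sb; apply: Sa => t Tt; apply/Sb => s Ts; apply: T_comm.
have [K [v vP]] := commutative_divring_field clS hD comS.
have [|sigma yv] := @conjugation_endomorphism D K v y uy.
  move=> k; apply/vP; have /SP Sk : v k \in S by apply/vP; exists k.
  apply/SP => w cw.
  have uyV : y^-1 \is a GRing.unit by rewrite unitrV.
  have -> : w = y * (y^-1 * w * y^-1^-1) * y^-1.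
    by rewrite invrK -!mulrA mulrV // mulr1 mulVKr.
  apply: comm_conj => //; apply: Sk => s Ts.
  have -> : s = y^-1 * (y * s * y^-1) * y^-1^-1.
    by rewrite invrK -!mulrA mulVr // mulr1 mulKr.
  by apply: comm_conj => //; apply/cw/T_conj.
have [xk xkE] : exists k, v k = x by apply/vP/TS; left; exists 0%N; rewrite f0.
have [c cE] : exists k, v k = y ^+ n by apply/vP/TS; right.
have iterE i k : y ^+ i * v k = v (iter i sigma k) * y ^+ i by apply: YXv.
have xk0 : xk != 0.
  by apply: contraTneq ux => xk0; rewrite -xkE xk0 rmorph0 unitr0.
have x_orbit i : (0 < i < n)%N -> iter i sigma xk <> xk.
  move=> /andP[i_gt0 lt_in] E.
  have /n_min : (0 < i)%N && (y ^+ i * x == x * y ^+ i).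
    by rewrite i_gt0; apply/eqP; have := iterE i xk; rewrite E xkE.
  by rewrite leqNgt lt_in.
have centralE z : center D z -> exists k, v k = z.
  by move=> cz; apply/vP/SP => w _; apply: cz.
have [qx qxE] := central_poly_descent (fun i => centralE _ (cpx i)).
have [qy qyE] := central_poly_descent (fun i => centralE _ (cpy i)).
have fixed k : center D (v k) -> sigma k = k.
  by move=> ck; apply: (fmorph_inj v); apply: (mulIr uy); rewrite -yv (ck y).
have coef_fixed (p : {poly D}) (q : {poly K}) : map_poly v q = p -> (forall i, center D p`_i) ->
    forall i, sigma q`_i = q`_i.
  by move=> qE cp j; apply: fixed; rewrite -coef_map qE.
have q_root (q : {poly K}) k : root (map_poly v q) (v k) -> root q k.
  by rewrite /root horner_map -{1}(rmorph0 v) (inj_eq (fmorph_inj v)).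
(* Only the coefficients of the two equations need to be algebraic over P; being central, they are
   fixed by sigma. *)
pose l := (qx : seq K) ++ qy.
have fix_l z : z \in l -> sigma z = z.
  by rewrite mem_cat => /orP[]/(nthP 0)[j _ <-];
    [exact: coef_fixed qxE _ _ | exact: coef_fixed qyE _ _].
have alg_root (P : idomainType) (iota : {rmorphism P -> K}) (q : {poly K}) k :
    injective iota -> q != 0 -> root q k -> {subset (q : seq K) <= l} ->
    (forall z, z \in l -> alg_over iota z) -> alg_over iota k.
  move=> i_inj q0 qk ql al; apply: alg_trans qk _ => // j.
  have [hj|hj] := ltnP j (size q); first by apply/al/ql/mem_nth.
  by rewrite nth_default // -(rmorph0 iota); apply: alg_id.
have qx0 : qx != 0 by apply: contraNneq px0 => q0; rewrite -qxE q0 rmorph0.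
have qy0 : qy != 0 by apply: contraNneq py0 => q0; rewrite -qyE q0 rmorph0.
have rqx : root qx xk by apply: q_root; rewrite qxE xkE.
have rqy : root qy c by apply: q_root; rewrite qyE cE.
have qxl : {subset (qx : seq K) <= l} by move=> z zq; rewrite mem_cat zq.
have qyl : {subset (qy : seq K) <= l} by move=> z zq; rewrite mem_cat zq orbT.
have [[p [charKp al]]|[P [iota [base al]]]] := base_ring fix_l.
  case: xy; rewrite /GRing.comm -xkE; apply/esym.
  apply: (frobenius_fixed_commute hD yv n_gt0 (esym cE) charKp).
  - exact/alg_Fp_frobenius/(alg_root _ _ _ _ (fmorph_inj _) qx0 rqx qxl al).
  - exact/alg_Fp_frobenius/(alg_root _ _ _ _ (fmorph_inj _) qy0 rqy qyl al).
have [i_inj _ _ _] := base.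
have alg_xk := alg_root _ _ _ _ i_inj qx0 rqx qxl al.
have alg_ck := alg_root _ _ _ _ i_inj qy0 rqy qyl al.
have [A [uA W]] := crossed_free_pair hD yv uy n_gt1 (esym cE) x_orbit xk0 base alg_xk alg_ck.
exists A; split=> // J w w0 sw; have := W J w w0 sw.
by rewrite fmorphV xkE.
Qed.

(** * Solvable, subnormal and free subgroups *)

Section Subgroups.
Local Open Scope classical_set_scope.
Local Open Scope group_scope.
Variable G : groupType.
Implicit Types (H A B : set G) (x y : G).

Lemma subgroupV H x : is_subgroup H -> H x -> H x^-1.
Proof. by move=> [H1 HV] Hx; rewrite -[x^-1]mul1g; apply: HV. Qed.

Lemma subgroupM H x y : is_subgroup H -> H x -> H y -> H (x * y).
Proof.
move=> sH Hx Hy; rewrite -[y]invgK; case: (sH) => _; apply=> //.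
exact: subgroupV.
Qed.

Lemma subgroupX H x n : is_subgroup H -> H x -> H (x ^+ n).
Proof.
move=> sH Hx; elim: n => [|n IH]; first by case: sH.
by rewrite expgS; apply: subgroupM.
Qed.

Lemma subgroupR H x y : is_subgroup H -> H x -> H y -> H [~ x, y].
Proof.
by move=> sH Hx Hy; do !(apply: subgroupM => //); apply: subgroupV.
Qed.

Lemma sub_gen A : A `<=` gen A.
Proof. exact: sub_smallest. Qed.

Lemma gen_sub A H : is_subgroup H -> A `<=` H -> gen A `<=` H.
Proof. by move=> sH AH; apply: smallest_sub. Qed.

Lemma subgroup_gen A : is_subgroup (gen A).
Proof.
split=> [B [sB _]|x y gx gy B [sB AB]]; first by case: sB.
by case: (sB) => _; apply; [apply: gx | apply: gy].
Qed.

Lemma derived_subgroup H n : is_subgroup H -> is_subgroup (derived_series H n).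
Proof. by case: n => // n _; apply: subgroup_gen. Qed.

Lemma derived_sub H n : is_subgroup H -> derived_series H n `<=` H.
Proof.
move=> sH; elim: n => [|n IH] //; apply: gen_sub => // _ [x [y [Dx Dy ->]]].
by apply: subgroupR => //; apply: IH.
Qed.

(* At the last nonabelian term L of the derived series, [x, y^-i] lies in the
   abelian group L'; either some x in L' is not central in L, or L' is central. *)
Lemma solvable_commuting_conjugates H : is_subgroup H -> ~ is_abelian H -> is_solvable H ->
  exists x y, [/\ H x, H y, ~ commute x y & forall i, commute x (y ^+ i * x * y ^- i)].
Proof.
move=> sH nabH [n0 sol].
have ex_ab : exists n, `[< is_abelian (derived_series H n) >].
  by exists n0; apply/asboolP; rewrite sol => x y /= -> ->.
case: (ex_minnP ex_ab) => n /asboolP abn n_min.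
case: n => [|n] in abn n_min *; first by [].
set L := derived_series H n; set L' := derived_series H n.+1 in abn.
have sL : is_subgroup L by apply: derived_subgroup.
have LH : L `<=` H by apply: derived_sub.
have L'L : L' `<=` L by apply: gen_sub => // _ [x [y [Lx Ly ->]]]; apply: subgroupR.
have RL' x y : L x -> L y -> L' [~ x, y] by move=> Lx Ly; apply: sub_gen; exists x, y.
have nabL : ~ is_abelian L.
  by move=> /asboolP/n_min; rewrite ltnn.
have conj x y i : commute x [~ x, y ^- i] -> commute x (y ^+ i * x * y ^- i).
  move=> c; have -> : y ^+ i * x * y ^- i = x * [~ x, y ^- i].
    by rewrite /commg /conjg invgK mulVKg mulgA.
  exact: commuteM.
have [[x [y [L'x Ly nxy]]]|cent] :=
  pselect (exists x y, [/\ L' x, L y & ~ commute x y]).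
  exists x, y; split=> // [||i]; [exact/LH/L'L|exact: LH|].
  apply/conj/abn => //; apply: RL'; first exact: L'L.
  by apply: subgroupV => //; apply: subgroupX.
have [x [y [Lx Ly nxy]]] : exists x y, [/\ L x, L y & ~ commute x y].
  apply: contrapT => H0; apply: nabL => x y Lx Ly; apply: contrapT => nxy.
  by apply: H0; exists x, y.
exists x, y; split=> // [||i]; [exact: LH|exact: LH|].
apply/conj/commute_sym; apply: contrapT => nc; apply: cent.
exists [~ x, y ^- i], x; split=> //; apply: RL' => //.
by apply: subgroupV => //; apply: subgroupX.
Qed.

Lemma subnormal_subgroup N H : is_subnormal N H -> is_subgroup N.
Proof.
move=> [sH [[|n] [S [S0 <- hS]]]]; first by rewrite S0.
by case: (hS n (ltnSn n)).
Qed.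

(** As x lies in every S i, the identity [u, x] = (x^-1)^u x moves u from S i into S (i+1); n steps
    reach N, which is then never left. *)
Lemma subnormal_commutators N : is_subnormal N [set: G] -> exists n, forall a x j,
  N x -> N (iter (n + j) (fun u => [~ u, x]) a).
Proof.
move=> sN; have sgN := subnormal_subgroup sN; case: sN => _ [n [S [S0 Sn hS]]].
exists n => a x j Nx.
have Sx i : (i <= n)%N -> S i x.
  move=> le_in; rewrite -(subKn le_in); elim: (n - i)%N (leq_subr i n) => [|k IH] le_k.
    by rewrite subn0 Sn.
  have lt_k : (n - k.+1 < n)%N by rewrite ltn_subrL (leq_ltn_trans _ le_k).
  have [_ _ sub _] := hS _ lt_k; apply: sub.
  by rewrite -subSn // subSS; apply/IH/ltnW.
have Sc i : (i <= n)%N -> S i (iter i (fun u => [~ u, x]) a).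
  elim: i => [|i IH] lt_in; first by rewrite S0.
  have [sS _ _ nS] := hS i lt_in; rewrite iterS; set c := iter i _ _.
  have -> : [~ c, x] = x^-1 ^ c * x by rewrite /commg /conjg !mulgA.
  apply: subgroupM => //; last exact: Sx.
  by apply: nS; [by apply: subgroupV => //; apply: Sx | exact/IH/ltnW].
elim: j => [|j IH]; first by rewrite addn0 -Sn; apply: Sc.
by rewrite addnS iterS; apply: subgroupR.
Qed.

(** The word g(true) g(false)^-1 shows that g is injective, and the commutator word that the group
    is not abelian. *)
Lemma free_of_reduced_words (g : bool -> G) :
  (forall w : seq (bool * bool), w != [::] -> sorted nocancel w ->
    word_val [seq (g a.1, a.2) | a <- w] <> 1) ->
  is_free (gen (range g)) /\ ~ is_abelian (gen (range g)).
Proof.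
move=> hw.
have g_neq : g true != g false.
  apply/eqP => gE; apply: (hw [:: (true, true); (false, false)]) => //=.
  by rewrite /word_val big_cons big_seq1 /= gE mulgV.
split; last first.
  move=> ab; apply: (hw [:: (true, true); (false, true); (true, false); (false, false)]) => //.
  have gK i : gen (range g) (g i) by apply: sub_gen; exists i.
  rewrite /word_val !big_cons big_nil /= mulg1 mulgA (ab _ _ (gK true) (gK false)).
  by rewrite mulgA mulgK mulgV.
exists (range g); split=> // w wX wR w0.
(* Injectivity of g lets each letter be relabelled by a boolean, which turns a reduced word over the
   range into a reduced word in the labels. *)
pose idx (a : G * bool) := (a.1 == g true, a.2).
pose onX := [pred a : G * bool | (a.1 == g true) || (a.1 == g false)].
have allX : all onX w.
  by apply/allP => -[z e] /wX /= [[] _ <-]; rewrite eqxx ?orbT.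
have wE : w = [seq (g a.1, a.2) | a <- map idx w].
  rewrite -map_comp -[LHS]map_id; apply/eq_in_map => -[z e] /(allP allX) /=.
  rewrite /idx /=; case: (eqVneq z (g true)) => [-> //|_ /= /eqP ->] //.
rewrite wE; apply: hw; first by case: (w) w0.
rewrite sorted_map; apply: (sub_in_sorted _ allX) wR => a b aX bX /=.
rewrite /nocancel /idx /=; apply: contra => /andP[/eqP E ->]; rewrite andbT.
move: aX bX E; rewrite !inE; case: (eqVneq a.1 (g true)) => [->|_] /=.
  by case: (eqVneq b.1 (g true)) => [->|//].
by move=> /eqP ->; case: (eqVneq b.1 (g true)) => //= _ /eqP ->.
Qed.

End Subgroups.

(** * A non-abelian free subgroup inside N *)

Theorem theorem4p3 (D : unitRingType) (hD : is_division_ring D)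
    (N H : set (unit_group D))
    (hN : is_subnormal N [set: unit_group D])
    (hH : is_subgroup H) (hHN : H `<=` N)
    (hHab : ~ is_abelian H) (hHsol : is_solvable H)
    (hHalg : algebraic_over (center D) [set unit_val u | u in H]) :
  exists K : set (unit_group D),
    [/\ is_subgroup K, K `<=` N, is_free K & ~ is_abelian K].
Proof.
have [x [y [Hx Hy nxy xconj]]] := solvable_commuting_conjugates hH hHab hHsol.
have valX (u : unit_group D) i : val (u ^+ i)%g = (val u ^+ i)%R.
  by elim: i => [|i IH] //; rewrite expgS exprS -IH.
have alg_H (u : unit_group D) : H u -> algebraic_over (center D) [set val u].
  by move=> Hu _ ->; apply: hHalg; exists u.
have [|i||k|A [uA hA]] := @free_pair D (val x) (val y) hD (valP x) (valP y).
- by move=> E; apply: nxy; apply: val_inj.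
- by have := congr1 val (xconj i); rewrite /= !valX.
- exact: alg_H.
- by rewrite -valX; apply: alg_H; apply: subgroupX.
have [n hn] := subnormal_commutators hN.
pose AU i : unit_group D := UnitGroup (uA i).
(* The first n commutators bring the element into N; the two further ones match the index [J.+2] of
   [free_pair] with J = n. *)
pose g i := iter n.+2 (fun u => [~ u, x]%g) (AU i).
have gN i : N (g i).
  by rewrite /g -addn2; apply: hn; apply: hHN.
have gE i : val (g i) = iter n.+2 (fun u => u^-1 * (val x)^-1 * u * val x)%R (A i).
  by rewrite /g; elim: n.+2 => //= m <-; rewrite !mulrA.
have [freeK nabK] : is_free (gen (range g)) /\ ~ is_abelian (gen (range g)).
  apply: free_of_reduced_words => w w0 sw /(congr1 val) E.
  apply: (hA n w w0 sw);
  rewrite -[RHS]E /word_val big_map (big_morph val (id1 := 1%R) (op1 := *%R)) //.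
  by apply: eq_bigr => a _; rewrite -!gE; case: a.2.
exists (gen (range g)); split=> //; first exact: subgroup_gen.
by apply: gen_sub; [exact: subnormal_subgroup hN | move=> _ [i _ <-]].
Qed.
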